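(* Let $F$ be a (non-Archimedean) local field with ring of integers $\mathcal O$ and residue field of size $q$, endowed with the metric $d_v(a,b)=q^{-v(a-b)}$ induced by its valuation $v$. Then (i) the group $\mathrm{Isom}(\mathcal O)$ of isometries of $\mathcal O$ is isomorphic to the group $\mathrm{Aut}(T_q)$ of automorphisms of the $q$-regular rooted tree $T_q$; (ii) the group $\mathrm{Isom}(F)$ of isometries of $F$ is isomorphic to the group $\mathrm{Aut}_0(\widetilde T_{q+1})_{\omega}$ of automorphisms of $\widetilde T_{q+1}$ that eventually fix the vertices of the rays representing a distinguished end $\omega$; (iii) the group $\mathcal D(F)$ of dilations of $F$ is isomorphic to the group $\mathrm{Aut}(\widetilde T_{q+1})_{\omega}$ of automorphisms of $\widetilde T_{q+1}$ that fix the end $\omega$ as a point of the boundary of $\widetilde T_{q+1}$ (but possibly move the vertices of rays corresponding to $\omega$ along those rays).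
   Context: A discrete valuation on a commutative field $F$ is a homomorphism $v$ from the multiplicative group $F^*$ onto $\mathbb Z$ with $v(a+b)\ge\inf\{v(a),v(b)\}$ for all $a,b\in F$, with the convention $v(0)=\infty$. Put $\mathcal O=\{a\in F: v(a)\ge 0\}$ (ring of integers) and let $\mathfrak m$ be the maximal ideal of $\mathcal O$. $F$ is a (non-Archimedean) local field if the cardinality $q$ of the residue field $\mathcal O/\mathfrak m$ is finite and $F$ is complete for the metric $d_v(a,b)=q^{-v(a-b)}$. A dilation of a metric space $(Y,d_Y)$ is a homeomorphism $f:Y\to Y$ for which there is $\lambda>0$ such that $d_Y(f(x),f(y))=\lambda d_Y(x,y)$ for all $x,y\in Y$. $T_q$ is the rooted tree in which every vertex has exactly $q$ children; its automorphisms fix the root and preserve adjacency. $\widetilde T_{q+1}$ is the (unrooted) $(q+1)$-regular tree. An end of it is an equivalence class of infinite geodesic rays, two rays being equivalent if they coincide from some point on; the ends form the boundary. Fix an end $\omega$ and a ray $(v_n)_{n\ge 0}$ representing it. $\mathrm{Aut}(\widetilde T_{q+1})_\omega$ is the group of automorphisms $g$ of $\widetilde T_{q+1}$ fixing $\omega$, i.e. for which there are $N,k\in\mathbb Z$ with $g(v_n)=v_{n-k}$ for all $n\ge N$. $\mathrm{Aut}_0(\widetilde T_{q+1})_\omega$ is the subgroup of those $g$ for which there is $N$ with $g(v_n)=v_n$ for all $n\ge N$. *)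

(* Defs.v *)
From HB Require Import structures.
From mathcomp Require Import all_boot all_order all_algebra.
From mathcomp Require Import all_classical all_reals all_analysis.
From mathcomp Require Import zify.

Set Implicit Arguments.
Unset Strict Implicit.
Unset Printing Implicit Defensive.

Import Order.TTheory GRing.Theory Num.Theory.

Local Open Scope classical_set_scope.
Local Open Scope card_scope.
Local Open Scope ring_scope.

Record bij (T : Type) := Bij {
  bij_fun :> T -> T;
  bij_inv : T -> T;
  bij_funK : cancel bij_fun bij_inv;
  bij_invK : cancel bij_inv bij_fun
}.

Section BijGroup.
Variable T : Type.

Lemma bijP (f g : bij T) : f =1 g -> f = g.
Proof.
case: f g => [f f' fK f'K] [g g' gK g'K] /= fg.
have e : f = g by apply/funext.
have e' : f' = g' by apply/funext => x; rewrite -{2}(f'K x) fg gK.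
by clear fg; subst g g'; congr Bij; exact: Prop_irrelevance.
Qed.

HB.instance Definition _ := gen_eqMixin (bij T).
HB.instance Definition _ := gen_choiceMixin (bij T).

Definition bij_one : bij T := @Bij T idfun idfun (frefl _) (frefl _).

Definition bij_mul (f g : bij T) : bij T :=
  Bij (can_comp (bij_funK f) (bij_funK g))
      (can_comp (bij_invK g) (bij_invK f)).

Definition bij_opp (f : bij T) : bij T := Bij (bij_invK f) (bij_funK f).

Fact bij_mulA : associative bij_mul.
Proof. by move=> f g h; apply: bijP. Qed.
Fact bij_mul1 : left_id bij_one bij_mul.
Proof. by move=> f; apply: bijP. Qed.
Fact bij_1mul : right_id bij_one bij_mul.
Proof. by move=> f; apply: bijP. Qed.
Fact bij_mulV : left_inverse bij_one bij_opp bij_mul.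
Proof. by move=> f; apply: bijP => x /=; exact: bij_funK. Qed.
Fact bij_Vmul : right_inverse bij_one bij_opp bij_mul.
Proof. by move=> f; apply: bijP => x /=; exact: bij_invK. Qed.

HB.instance Definition _ :=
  isGroup.Build (bij T) bij_mulA bij_mul1 bij_1mul bij_mulV bij_Vmul.

Lemma bij1E x : (1%g : bij T) x = x. Proof. by []. Qed.
Lemma bijME (f g : bij T) x : (f * g)%g x = f (g x). Proof. by []. Qed.
Lemma bijVK (f : bij T) : cancel f (f^-1)%g. Proof. exact: bij_funK. Qed.
Lemma bijKV (f : bij T) : cancel (f^-1)%g f. Proof. exact: bij_invK. Qed.

End BijGroup.

Record subgroup (G : groupType) (S : groupClosed G) := Subgroup {
  subgroup_val :> G;
  subgroupP : subgroup_val \in S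
}.

Section SubgroupGroup.
Variables (G : groupType) (S : groupClosed G).

HB.instance Definition _ := [isSub for @subgroup_val G S].
HB.instance Definition _ := [Choice of subgroup S by <:].

Fact subgroup_closed : group_closed [in S].
Proof. by split; [exact: gpred1 | exact: gpredF]. Qed.

HB.instance Definition _ :=
  SubChoice_isSubGroup.Build G [in S] (subgroup S) subgroup_closed.

End SubgroupGroup.

Definition isomorphic (G H : groupType) : Prop :=
  exists f : {multiplicative G -> H}, bijective f.

Section MetricGroups.
Variables (R : realType) (Y : metricType R).

Definition isometry_pred : {pred bij Y} :=
  [pred f : bij Y | `[< forall x y, mdist (f x) (f y) = mdist x y >]].

Fact isometry_mulg : mulg_closed isometry_pred.
Proof. by move=> f g /asboolP fi /asboolP gi; apply/asboolP => x y; rewrite !bijME fi gi. Qed.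
Fact isometry_one : 1%g \in isometry_pred.
Proof. exact/asboolP. Qed.
Fact isometry_invg : invg_closed isometry_pred.
Proof. by move=> f /asboolP fi; apply/asboolP => x y; rewrite -fi !bijKV. Qed.

HB.instance Definition _ := isMulClosed.Build _ isometry_pred isometry_mulg.
HB.instance Definition _ := isMul1Closed.Build _ isometry_pred isometry_one.
HB.instance Definition _ := isInvClosed.Build _ isometry_pred isometry_invg.

Definition Isom : groupType := subgroup isometry_pred.

Definition homeomorphism (f : bij Y) : Prop :=
  continuous f /\ continuous (f^-1)%g.

Definition dilation_pred : {pred bij Y} :=
  [pred f : bij Y | `[< homeomorphism f /\
     exists2 l : R, 0 < l & forall x y, mdist (f x) (f y) = l * mdist x y >]].

Fact dilation_mulg : mulg_closed dilation_pred.
Proof.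
move=> f g /asboolP[[fc fVc] [k k0 fk]] /asboolP[[gc gVc] [l l0 gl]].
apply/asboolP; split; first split.
- by move=> x; apply: (@continuous_comp _ _ _ g f); [exact: gc | exact: fc].
- move=> x; apply: (@continuous_comp _ _ _ (f^-1)%g (g^-1)%g).
    exact: fVc.
  exact: gVc.
- by exists (k * l); [exact: mulr_gt0 | move=> x y; rewrite !bijME fk gl mulrA].
Qed.
Fact dilation_one : 1%g \in dilation_pred.
Proof.
apply/asboolP; split; first by split=> x; exact: cvg_id.
by exists 1 => // x y; rewrite mul1r.
Qed.
Fact dilation_invg : invg_closed dilation_pred.
Proof.
move=> f /asboolP[[fc fVc] [k k0 fk]]; apply/asboolP; split.
  by split=> //; rewrite invgK.
exists k^-1; first by rewrite invr_gt0.
by move=> x y; rewrite -{2}(bijKV f x) -{2}(bijKV f y) fk mulKf ?gt_eqF.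
Qed.

HB.instance Definition _ := isMulClosed.Build _ dilation_pred dilation_mulg.
HB.instance Definition _ := isMul1Closed.Build _ dilation_pred dilation_one.
HB.instance Definition _ := isInvClosed.Build _ dilation_pred dilation_invg.

Definition Dil : groupType := subgroup dilation_pred.

End MetricGroups.

Section SubspaceMetric.
Variables (R : realType) (Y : metricType R) (A : set Y).

Definition sub_mdist (x y : set_type A) : R := mdist (set_val x) (set_val y).

Fact sub_mdist_ge0 x y : 0 <= sub_mdist x y. Proof. exact: mdist_ge0. Qed.
Fact sub_mdist_pos x y : sub_mdist x y = 0 -> x = y.
Proof. by move=> /mdist_positivity; rewrite set_valE => /val_inj. Qed.
Fact sub_mdist_ball (x : set_type A) d :
  ball x d = [set y | sub_mdist x y < d].
Proof.
have -> : ball x d = set_val @^-1` (ball (set_val x) d) by [].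
by rewrite ballEmdist.
Qed.

HB.instance Definition _ := @PseudoMetric_isMetric.Build R (set_type A)
  sub_mdist sub_mdist_ge0 sub_mdist_pos sub_mdist_ball.

Lemma set_type_mdistE (x y : set_type A) :
  mdist x y = mdist (set_val x) (set_val y).
Proof. by []. Qed.

End SubspaceMetric.

(* v 0 is a junk value: the convention v(0) = oo is rendered by never using it,
   here and in valuation_ring and vdist. *)
Record discrete_valuation (F : fieldType) (v : F -> int) : Prop := {
  valuationM : forall a b, a != 0 -> b != 0 -> v (a * b) = v a + v b;
  valuation_surj : forall n, exists2 a, a != 0 & v a = n;
  valuationD : forall a b, a != 0 -> b != 0 -> a + b != 0 ->
    Num.min (v a) (v b) <= v (a + b)
}.

Section ValuationRing.
Variables (F : fieldType) (v : F -> int).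

Definition valuation_ring : set F := [set a | a = 0 \/ 0 <= v a].

Record valuation_ideal (I : set F) : Prop := {
  ideal_sub : I `<=` valuation_ring;
  ideal0 : I 0;
  idealD : forall a b, I a -> I b -> I (a + b);
  idealM : forall a b, valuation_ring a -> I b -> I (a * b)
}.

Definition valuation_maximal_ideal (m : set F) : Prop :=
  [/\ valuation_ideal m, m <> valuation_ring &
   forall J, valuation_ideal J -> m `<=` J -> J = m \/ J = valuation_ring].

(* The underlying set of O/m, as the set of cosets a + m with a in O. *)
Definition residue_field (m : set F) : set (set F) :=
  [set [set a + x | x in m] | a in valuation_ring].

End ValuationRing.

Record valuedField := ValuedField {
  vf_field :> fieldType;
  valuation : vf_field -> int;
  valuationP : discrete_valuation valuation;
  vf_max : set vf_field;
  vf_maxP : valuation_maximal_ideal valuation vf_max;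
  residue_card : nat;
  residue_cardP : residue_field valuation vf_max #= `I_residue_card
}.

Arguments valuation : clear implicits.
Arguments vf_max : clear implicits.
Arguments residue_card : clear implicits.

Section ValuedFieldTheory.
Variable K : valuedField.
Local Notation v := (valuation K).
Local Notation q := (residue_card K).

Lemma valuation1 : v 1 = 0.
Proof.
have := valuationM (valuationP K) (oner_neq0 _) (oner_neq0 _).
by rewrite mulr1 => /eqP; rewrite -subr_eq0 opprD addNKr oppr_eq0 => /eqP.
Qed.

Lemma valuationN a : v (- a) = v a.
Proof.
have N10 : (-1 : K) != 0 by rewrite oppr_eq0 oner_eq0.
have vN1 : v (-1) = 0.
  have := valuationM (valuationP K) N10 N10.
  by rewrite mulrNN mulr1 valuation1; lia.
have [->|a0] := eqVneq a 0; first by rewrite oppr0.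
by rewrite -mulN1r (valuationM (valuationP K))// vN1 add0r.
Qed.

Lemma residue_card_gt1 : (1 < q)%N.
Proof.
have [mid mneq _] := vf_maxP K.
have m1 : ~ vf_max K 1.
  move=> m1; apply: mneq; apply/seteqP; split; first exact: (ideal_sub mid).
  by move=> a Oa; rewrite -(mulr1 a); exact: (idealM mid).
have O0 : valuation_ring v 0 by left.
have O1 : valuation_ring v 1 by right; rewrite valuation1.
have /card_set_bijP[f [fun_f inj_f _]] := residue_cardP K.
pose C a : set K := [set a + x | x in vf_max K].
have R0 : residue_field v (vf_max K) (C 0) by exists 0.
have R1 : residue_field v (vf_max K) (C 1) by exists 1.
have C01 : C 0 <> C 1.
  move=> e; have : C 0 1 by rewrite e; exists 0; [exact: ideal0 mid|rewrite addr0].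
  by case=> x mx; rewrite add0r => x1; apply: m1; rewrite -x1.
have f0 := fun_f _ R0; have f1 := fun_f _ R1.
rewrite ltnNge; apply/negP => q1; apply: C01; apply: inj_f; rewrite ?inE//.
by move: (f (C 0)) (f (C 1)) f0 f1 q1 => /= m n; lia.
Qed.

End ValuedFieldTheory.

(* K as a metric space; the alias carries the field R of distance values. *)
Definition vspace (R : realType) (K : valuedField) : Type := K.

Section ValuationMetric.
Variables (R : realType) (K : valuedField).
Local Notation v := (valuation K).
Local Notation q := (residue_card K).

Definition vdist (a b : K) : R :=
  if a == b then 0 else q%:R ^ (- v (a - b)).

HB.instance Definition _ := Choice.copy (vspace R K) K.
HB.instance Definition _ := isPointed.Build (vspace R K) (0 : K).

Let q1 : (1 : R) < q%:R. Proof. by rewrite ltr1n residue_card_gt1. Qed.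
Let q0 : (0 : R) < q%:R. Proof. exact: lt_trans ltr01 q1. Qed.

Lemma vdist_ge0 a b : 0 <= vdist a b.
Proof. by rewrite /vdist; case: ifP => // _; rewrite exprz_ge0// ltW. Qed.

Fact vdistxx a : vdist a a = 0. Proof. by rewrite /vdist eqxx. Qed.
Fact vdist_pos a b : vdist a b = 0 -> a = b.
Proof.
rewrite /vdist; case: ifP => [/eqP//|_ /eqP].
by rewrite expfz_eq0 (gt_eqF q0) andbF.
Qed.
Fact vdist_sym a b : vdist a b = vdist b a.
Proof. by rewrite /vdist eq_sym -(valuationN (a - b)) opprB. Qed.
Lemma vdist_ultra b a c : vdist a c <= Num.max (vdist a b) (vdist b c).
Proof.
have [->|ab] := eqVneq a b; first by rewrite le_max lexx orbT.
have [->|bc] := eqVneq b c; first by rewrite le_max lexx.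
have [->|ac] := eqVneq a c; first by rewrite vdistxx le_max vdist_ge0.
rewrite /vdist (negPf ab) (negPf bc) (negPf ac) le_max.
have := valuationD (valuationP K) (a := a - b) (b := b - c).
rewrite addrA subrK !subr_eq0 => /(_ ab bc ac).
rewrite ge_min => /orP[] h; apply/orP; [left|right];
  by rewrite ler_eXz2l// lerN2.
Qed.
Fact vdist_triangle b a c : vdist a c <= vdist a b + vdist b c.
Proof.
apply: le_trans (vdist_ultra b a c) _.
by rewrite ge_max lerDl lerDr !vdist_ge0.
Qed.

HB.instance Definition _ := @isMetric.Build R (vspace R K)
  vdist vdistxx vdist_pos vdist_sym vdist_triangle.

Lemma vspace_mdistE (a b : vspace R K) : mdist a b = vdist a b.
Proof. by []. Qed.

End ValuationMetric.

Record localField (R : realType) := LocalField {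
  lf_valued :> valuedField;
  lf_complete : forall G : set_system (vspace R lf_valued),
    ProperFilter G -> cauchy G -> cvg G
}.

Definition ring_of_integers (R : realType) (K : valuedField) :
  set (vspace R K) := valuation_ring (valuation K).
Arguments ring_of_integers : clear implicits.

Section Graph.
Variables (V : eqType) (e : rel V).

Definition walk (x y : V) (n : nat) : Prop :=
  exists p, [/\ path e x p, last x p = y & size p = n].

Definition gdist (x y : V) (n : nat) : Prop :=
  walk x y n /\ forall m, walk x y m -> (n <= m)%N.

Record tree : Prop := {
  tree_sym : symmetric e;
  tree_irr : irreflexive e;
  tree_connected : forall x y, exists n, walk x y n;
  tree_acyclic : forall c, cycle e c -> uniq c -> (size c <= 2)%N
}.

Definition regular_tree (d : nat) : Prop :=
  tree /\ forall x, [set y | e x y] #= `I_d.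

(* y is a child of x when r is the root. *)
Definition child (r x y : V) : Prop :=
  e x y /\ exists2 n, gdist r x n & gdist r y n.+1.

Definition rooted_regular_tree (r : V) (q : nat) : Prop :=
  tree /\ forall x, [set y | child r x y] #= `I_q.

Definition geodesic_ray (u : nat -> V) : Prop :=
  forall m n, (m <= n)%N -> gdist (u m) (u n) (n - m).

(* Rays coincide from some point on, up to a shift of the parametrization. *)
Definition same_tail (u w : nat -> V) : Prop :=
  exists a b, forall n, u (a + n)%N = w (b + n)%N.

Definition is_end (W : set (nat -> V)) : Prop :=
  exists2 u, geodesic_ray u & W = [set w | geodesic_ray w /\ same_tail u w].

Definition automorphism (g : bij V) : Prop := forall x y, e (g x) (g y) = e x y.

Fact automorphismM g h :
  automorphism g -> automorphism h -> automorphism (g * h)%g.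
Proof. by move=> ga ha x y; rewrite !bijME ga ha. Qed.
Fact automorphismV g : automorphism g -> automorphism (g^-1)%g.
Proof. by move=> ga x y; rewrite -ga !bijKV. Qed.

Definition rooted_aut_pred (r : V) : {pred bij V} :=
  [pred g : bij V | `[< automorphism g /\ g r = r >]].

Definition fixes_end (W : set (nat -> V)) (g : bij V) : Prop :=
  [set (g \o u : nat -> V) | u in W] = W.

Definition end_aut_pred (W : set (nat -> V)) : {pred bij V} :=
  [pred g : bij V | `[< automorphism g /\ fixes_end W g >]].

Definition end_aut0_pred (u : nat -> V) : {pred bij V} :=
  [pred g : bij V | `[< automorphism g /\
     exists N, forall n, (N <= n)%N -> g (u n) = u n >]].

Fact rooted_aut_mulg r : mulg_closed (rooted_aut_pred r).
Proof.
move=> g h /asboolP[ga gr] /asboolP[ha hr]; apply/asboolP.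
by split; [exact: automorphismM | rewrite bijME hr].
Qed.
Fact rooted_aut_one r : 1%g \in rooted_aut_pred r.
Proof. exact/asboolP. Qed.
Fact rooted_aut_invg r : invg_closed (rooted_aut_pred r).
Proof.
move=> g /asboolP[ga gr]; apply/asboolP.
by split; [exact: automorphismV | rewrite -{1}gr bijVK].
Qed.

HB.instance Definition _ r :=
  isMulClosed.Build _ (rooted_aut_pred r) (@rooted_aut_mulg r).
HB.instance Definition _ r :=
  isMul1Closed.Build _ (rooted_aut_pred r) (rooted_aut_one r).
HB.instance Definition _ r :=
  isInvClosed.Build _ (rooted_aut_pred r) (@rooted_aut_invg r).

Fact end_aut_mulg W : mulg_closed (end_aut_pred W).
Proof.
move=> g h /asboolP[ga gW] /asboolP[ha hW]; apply/asboolP.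
split; first exact: automorphismM.
by rewrite /fixes_end -[RHS]gW -{2}hW image_comp.
Qed.
Fact end_aut_one W : 1%g \in end_aut_pred W.
Proof. by apply/asboolP; split=> //; exact: image_id. Qed.
Fact end_aut_invg W : invg_closed (end_aut_pred W).
Proof.
move=> g /asboolP[ga gW]; apply/asboolP; split; first exact: automorphismV.
have gVg u : (g^-1)%g \o (g \o u) = u by apply/funext => n; exact: bijVK.
rewrite /fixes_end -{1}gW image_comp -[RHS]image_id.
by apply: eq_imagel => u _; exact: gVg.
Qed.

HB.instance Definition _ W :=
  isMulClosed.Build _ (end_aut_pred W) (@end_aut_mulg W).
HB.instance Definition _ W :=
  isMul1Closed.Build _ (end_aut_pred W) (end_aut_one W).
HB.instance Definition _ W :=
  isInvClosed.Build _ (end_aut_pred W) (@end_aut_invg W).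

Fact end_aut0_mulg u : mulg_closed (end_aut0_pred u).
Proof.
move=> g h /asboolP[ga [M gM]] /asboolP[ha [N hN]]; apply/asboolP.
split; first exact: automorphismM.
by exists (maxn M N) => n; rewrite geq_max bijME => /andP[Mn Nn]; rewrite hN// gM.
Qed.
Fact end_aut0_one u : 1%g \in end_aut0_pred u.
Proof. by apply/asboolP; split=> //; exists 0. Qed.
Fact end_aut0_invg u : invg_closed (end_aut0_pred u).
Proof.
move=> g /asboolP[ga [N gN]]; apply/asboolP; split; first exact: automorphismV.
by exists N => n Nn; rewrite -{1}(gN n Nn) bijVK.
Qed.

HB.instance Definition _ u :=
  isMulClosed.Build _ (end_aut0_pred u) (@end_aut0_mulg u).
HB.instance Definition _ u :=
  isMul1Closed.Build _ (end_aut0_pred u) (end_aut0_one u).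
HB.instance Definition _ u :=
  isInvClosed.Build _ (end_aut0_pred u) (@end_aut0_invg u).

Definition RootedAut (r : V) : groupType := subgroup (rooted_aut_pred r).
Definition EndAut (W : set (nat -> V)) : groupType := subgroup (end_aut_pred W).
Definition EndAut0 (u : nat -> V) : groupType := subgroup (end_aut0_pred u).

Lemma same_tail_sym u w : same_tail u w -> same_tail w u.
Proof. by move=> [a [b h]]; exists b, a. Qed.

Lemma same_tail_trans u v w : same_tail u v -> same_tail v w -> same_tail u w.
Proof.
move=> [a [b h]] [c [d k]]; exists (a + c)%N, (d + b)%N => n.
by rewrite -addnA h addnCA k addnA.
Qed.

Lemma same_tail_comp (g : V -> V) u w :
  same_tail u w -> same_tail (g \o u) (g \o w).
Proof. by move=> [a [b h]]; exists a, b => n /=; rewrite h. Qed.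

Lemma automorphism_walk g x y n :
  automorphism g -> walk x y n -> walk (g x) (g y) n.
Proof.
move=> ga [p [ep lp sp]]; exists (map g p); split; last by rewrite size_map.
  by rewrite path_map (eq_path (e' := e))// => a b; exact: ga.
by rewrite last_map lp.
Qed.

Lemma automorphism_ray g u :
  automorphism g -> geodesic_ray u -> geodesic_ray (g \o u).
Proof.
move=> ga hu m n mn; have [wk mi] := hu m n mn.
split; first exact: automorphism_walk.
move=> k /(automorphism_walk (automorphismV ga)).
by rewrite !bijVK; exact: mi.
Qed.

(* The usual description of the stabilizer of an end: g (v n) = v (n - k) for n
   large enough. *)
Lemma fixes_endP W v g : is_end W -> W v -> automorphism g ->
  fixes_end W g <->
  exists N k : int, forall n : nat, N <= n%:Z ->
    exists2 m : nat, m%:Z = n%:Z - k & g (v n) = v m.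
Proof.
move=> [u0 u0r ->] [vr u0v] ga.
have inW w : geodesic_ray w -> same_tail v w ->
    [set w | geodesic_ray w /\ same_tail u0 w] w.
  by move=> wr vw; split=> //; exact: same_tail_trans vw.
split=> [gW|[N [k h]]].
  have : [set w | geodesic_ray w /\ same_tail u0 w] (g \o v).
    by rewrite -gW; exists v.
  move=> [_ /(same_tail_trans (same_tail_sym u0v))[a [b h]]].
  exists b%:Z, (b%:Z - a%:Z) => n bn; exists (a + (n - b))%N; first lia.
  by rewrite h /=; congr (g (v _)); lia.
have vgv : same_tail v (g \o v).
  have [m mE _] := h `|N|%N ltac:(lia).
  exists m, `|N|%N => n /=.
  have [m' m'E ->] := h (`|N| + n)%N ltac:(lia).
  by congr v; lia.
apply/seteqP; split=> [_ [w [wr u0w] <-]|w [wr u0w]].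
  apply: inW; first exact: automorphism_ray.
  apply: same_tail_trans vgv _; apply: same_tail_comp.
  exact: same_tail_trans (same_tail_sym u0v) u0w.
exists ((g^-1)%g \o w); last by apply/funext => n; exact: bijKV.
apply: inW; first exact: automorphism_ray (automorphismV ga) wr.
have := same_tail_trans (same_tail_sym (same_tail_trans u0v vgv)) u0w.
move=> /(same_tail_comp (g^-1)%g); congr same_tail.
by apply/funext => n; exact: bijVK.
Qed.

End Graph.

(* Main.v *)
(* Let v be the valuation of F.  The balls of radius q^-n, n in Z, ordered by
   inclusion, form a tree in which every vertex has one parent and q children;
   when the tree of the statement is given an end (or a root), the neighbor of a
   vertex towards that end is its parent, and the Busemann function of the end
   (or the distance to the root) provides its level n.  Digits of the elements
   of F on one side and labels of the children of a vertex on the other side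
   identify the balls of radius q^-n with the vertices of level n.  Isometries,
   and more generally dilations of ratio q^-k, permute the balls and shift the
   levels by k; conversely a permutation of the vertices that commutes with the
   parent map permutes the decreasing sequences of balls, hence, as F is
   complete, the points of F.  The automorphisms fixing the end are exactly
   those permutations, and k = 0 for those that eventually fix the rays. *)
From HB Require Import structures.
From mathcomp Require Import all_boot all_order all_algebra.
From mathcomp Require Import all_classical all_reals all_analysis.
From mathcomp Require Import zify.
Require Import Defs.

Set Implicit Arguments.
Unset Strict Implicit.
Unset Printing Implicit Defensive.

Import Order.TTheory GRing.Theory Num.Theory.

Local Open Scope classical_set_scope.
Local Open Scope card_scope.
Local Open Scope ring_scope.

(** * Permutations of the points and of the balls *)

(** Any choice function for [rho] is a morphism: [rho] relates a product both to its chosen image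
    and to the product of the chosen images, and these agree by single-valuedness. *)
Lemma isomorphic_of_relation (G H : groupType) (rho : G -> H -> Prop) :
  (forall x, exists y, rho x y) -> (forall y, exists x, rho x y) ->
  (forall x y y', rho x y -> rho x y' -> y = y') ->
  (forall x x' y, rho x y -> rho x' y -> x = x') ->
  (forall x x' y y', rho x y -> rho x' y' -> rho (x * x')%g (y * y')%g) ->
  isomorphic G H.
Proof.
move=> tot surj fct inj mul.
have [f rf] := choice tot; have [g rg] := choice surj.
have fM : {morph f : x y / (x * y)%g}.
  by move=> x y; apply: fct (rf _) _; apply: mul; exact: rf.
pose f_mixin := isMultiplicative.Build G H f fM.
pose F : {multiplicative G -> H} := HB.pack f f_mixin.
exists F; exists g => [x|y]; first exact: inj (rg _) (rf _).
exact: fct (rf _) (rg _).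
Qed.

(** Every [k] qualifies when [D] is [setT], the levels for the whole field; only [k = 0] does when
    [D] is the set of nonnegative levels, used for the ring of integers. *)
Definition invariant_under (D : set int) (k : int) : Prop :=
  forall n, D n <-> D (n + k).

(* [beta a n] is the vertex of the ball of radius q^-n centered at [a]; [D] is
   the set of levels n that are considered. *)
Record ball_tree (Y V : Type) (D : set int) (p : V -> V) (lev : V -> int)
    (beta : Y -> int -> V) : Prop := {
  bt_succ : forall n, D n -> D (n + 1);
  bt_lev : forall a n, D n -> lev (beta a n) = n;
  bt_surj : forall x, D (lev x) /\ exists a, x = beta a (lev x);
  bt_parent : forall a n, D n -> p (beta a (n + 1)) = beta a n;
  bt_sep : forall a b, (forall n, D n -> beta a n = beta b n) -> a = b;
  bt_complete : forall u : int -> V,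
    (forall n, D n -> lev (u n) = n) ->
    (forall n, D n -> p (u (n + 1)) = u n) ->
    exists a, forall n, D n -> u n = beta a n;
  bt_split : forall n, D n ->
    exists a b, beta a n = beta b n /\ beta a (n + 1) <> beta b (n + 1)
}.

Section BallTree.
Variables (Y V : Type) (D : set int) (p : V -> V) (lev : V -> int).
Variable beta : Y -> int -> V.
Hypothesis bt : ball_tree D p lev beta.

Definition ball_shift (k : int) (f : Y -> Y) : Prop := forall a b n, D n ->
  (beta a n = beta b n <-> beta (f a) (n + k) = beta (f b) (n + k)).

(** The guard leaves out a root, where [p] takes a junk value. *)
Definition tree_shift (k : int) (g : V -> V) : Prop :=
  (forall x, lev (g x) = lev x + k) /\
  (forall x, D (lev x - 1) -> p (g x) = g (p x)).

Definition induces (k : int) (f : Y -> Y) (g : V -> V) : Prop :=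
  forall a n, D n -> g (beta a n) = beta (f a) (n + k).

Lemma ball_descend a b n m : D n -> beta a (n + m%:Z) = beta b (n + m%:Z) ->
  beta a n = beta b n.
Proof.
elim: m n => [|m IH] n Dn; first by rewrite addr0.
have -> : n + m.+1%:Z = (n + 1) + m%:Z by lia.
move=> /(IH _ (bt_succ bt Dn)) /(congr1 p).
by rewrite !(bt_parent bt).
Qed.

Lemma invariantN k : invariant_under D k -> invariant_under D (- k).
Proof. by move=> Dk n; have := Dk (n - k); rewrite subrK => ->. Qed.

Lemma ball_shiftV k (f : bij Y) : invariant_under D k -> ball_shift k (bij_fun f) ->
  ball_shift (- k) (bij_fun f^-1%g).
Proof.
move=> Dk fk a b n /(invariantN Dk) Dn.
by have := fk ((f^-1)%g a) ((f^-1)%g b) _ Dn; rewrite !bijKV subrK => ->.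
Qed.

Lemma tree_shiftV k (g : bij V) : invariant_under D k -> tree_shift k (bij_fun g) ->
  tree_shift (- k) (bij_fun g^-1%g).
Proof.
move=> Dk [gl gp]; split=> x.
  by rewrite -{2}(bijKV g x) gl addrK.
rewrite -{1 3}(bijKV g x) gl addrAC => /(Dk (_ - 1)) Dx.
by rewrite (gp _ Dx) bijVK.
Qed.

(** The image of a ball is computed from an arbitrary center [c x]; [fk] makes it independent of
    that center. *)
Lemma induced_tree_map k f : invariant_under D k -> ball_shift k f ->
  exists g, induces k f g.
Proof.
move=> Dk fk; have [c cE] := choice (fun x => (bt_surj bt x).2).
exists (fun x => beta (f (c x)) (lev x + k)) => a n Dn.
rewrite (bt_lev bt)//; apply/(fk _ _ _ Dn).
by have := cE (beta a n); rewrite (bt_lev bt).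
Qed.

(** The images under [g] of the balls around [a] form again a descending sequence, and completeness
    provides their common point. Its ball of level [n] comes from level [n - k]. *)
Lemma induced_ball_map k g : invariant_under D k -> tree_shift k g ->
  exists f, induces k f g.
Proof.
move=> Dk [gl gp].
have Dk' n : D n -> D (n - k) by move=> Dn; apply/(invariantN Dk n).
have H a : exists b, forall n, D n -> g (beta a (n - k)) = beta b n.
  apply: (bt_complete bt (u := fun n => g (beta a (n - k)))) => n /Dk' Dn.
    by rewrite gl (bt_lev bt)// subrK.
  have e : n + 1 - k = n - k + 1 by lia.
  rewrite e gp ?(bt_parent bt)//.
  by rewrite (bt_lev bt) ?addrK//; exact: (bt_succ bt).
have [f fE] := choice H; exists f => a n Dn.
by rewrite -fE ?addrK//; apply/(Dk n).
Qed.

Lemma induces_funK k f f' g g' : invariant_under D k ->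
  induces k f g -> induces (- k) f' g' -> cancel g g' -> cancel f f'.
Proof.
move=> Dk fg fg' gK a; apply: (bt_sep bt) => n Dn.
have Dnk : D (n + k) by apply/(Dk n).
by rewrite -{1}(addrK k n) -fg'// -fg.
Qed.

Lemma induces_treeK k f f' g g' : invariant_under D k ->
  induces k f g -> induces (- k) f' g' -> cancel f f' -> cancel g g'.
Proof.
move=> Dk fg fg' fK x; have [Dx [a ->]] := bt_surj bt x.
by rewrite fg// fg' ?addrK ?fK//; apply/(Dk (lev x)).
Qed.

Lemma induces_tree_shift k f g : invariant_under D k -> induces k f g ->
  tree_shift k g.
Proof.
move=> Dk fg; split=> x; have [Dx [a ->]] := bt_surj bt x.
  by rewrite fg// !(bt_lev bt)//; apply/(Dk (lev x)).
move: Dx; rewrite (bt_lev bt); last by case: (bt_surj bt x).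
move: (lev x) => n; have [m ->] : exists m, n = m + 1 by exists (n - 1); lia.
rewrite addrK => Dm1 Dm.
rewrite fg// (bt_parent bt)// fg// addrAC (bt_parent bt)//.
by apply/(Dk m).
Qed.

Lemma induces_ball_shift k f (g : bij V) : induces k f (bij_fun g) -> ball_shift k f.
Proof.
move=> fg a b n Dn; rewrite -!fg//; split=> [->//|].
exact: (can_inj (bij_funK g)).
Qed.

(** Take two points that share a ball of level [n] but not of level [n + 1]. If [k < k'], their
    preimages share level [n - k], so the points would share level [n - k + k'], which is at least
    [n + 1]. *)
Lemma shift_unique k k' f : D !=set0 -> invariant_under D k ->
  invariant_under D k' ->
  (forall y, exists x, f x = y) ->
  ball_shift k f -> ball_shift k' f -> k = k'.
Proof.
move=> D0 Dk Dk' fs fk fk'; have [n Dn] := D0.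
wlog kk' : k k' Dk Dk' fk fk' / k <= k'.
  by move=> W; have [/W|/ltW/W] := leP k k' => [->//|<-].
apply/eqP; rewrite eq_le kk' leNgt.
apply/negP => lt; have [c [d [cd]]] := bt_split bt Dn; apply.
have [a fa] := fs c; have [b fb] := fs d.
have Dnk : D (n - k) by exact/(invariantN Dk n).
have fkab := fk a b _ Dnk; rewrite subrK fa fb in fkab.
have := (fk' a b _ Dnk).1 (fkab.2 cd).
rewrite fa fb.
have -> : n - k + k' = n + 1 + (absz (k' - k - 1)%R)%:Z by lia.
exact: ball_descend (bt_succ bt Dn).
Qed.

(** [f] and [g] correspond when [g] moves the balls as [f] moves their centers. The shift can be
    recovered from [f] by [shift_unique] and from [g] by the levels, so each of the two maps
    determines the other. *)
Lemma isomorphic_ball_tree (K : set int) (A : groupClosed (bij Y))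
    (B : groupClosed (bij V)) :
  D !=set0 -> (forall k, K k -> invariant_under D k) ->
  (forall f : bij Y, f \in A <-> exists2 k, K k & ball_shift k (bij_fun f)) ->
  (forall g : bij V, g \in B <-> exists2 k, K k & tree_shift k (bij_fun g)) ->
  isomorphic (subgroup A) (subgroup B).
Proof.
move=> D0 KD memA memB.
pose rho (f : subgroup A) (g : subgroup B) := exists2 k,
  invariant_under D k & induces k (bij_fun (val f)) (bij_fun (val g)).
apply: (@isomorphic_of_relation _ _ rho).
- move=> [f fA]; have [k Kk fk] := (memA f).1 fA.
  have Dk := KD k Kk; have Dk' := invariantN Dk.
  have [g fg] := induced_tree_map Dk fk.
  (* The inverse of [g] is induced by the inverse of [f], with the opposite shift. *)
  have [g' fg'] := induced_tree_map Dk' (ball_shiftV Dk fk).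
  have gK : cancel g g' := induces_treeK Dk fg fg' (bij_funK f).
  have g'K : cancel g' g.
    apply: (induces_treeK Dk' fg' _ (bij_invK f)); first by rewrite opprK.
  have gB : Bij gK g'K \in B.
    by apply/memB; exists k => //; exact: induces_tree_shift fg.
  by exists (Subgroup gB); exists k.
- move=> [g gB]; have [k Kk gk] := (memB g).1 gB.
  have Dk := KD k Kk; have Dk' := invariantN Dk.
  have [f fg] := induced_ball_map Dk gk.
  have [f' fg'] := induced_ball_map Dk' (tree_shiftV Dk gk).
  have fK : cancel f f' := induces_funK Dk fg fg' (bij_funK g).
  have f'K : cancel f' f.
    by apply: (induces_funK Dk' fg' _ (bij_invK g)); rewrite opprK.
  have fA : Bij fK f'K \in A.
    by apply/memA; exists k => //; exact: (@induces_ball_shift k f g).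
  by exists (Subgroup fA); exists k.
- move=> f g g' [k Dk fg] [k' Dk' fg']; apply: val_inj; apply: bijP => x.
  have kk' : k = k'.
    apply: (@shift_unique k k' (bij_fun (val f))) => //.
    + by move=> y; exists ((val f)^-1 y)%g; exact: bijKV.
    + exact: (induces_ball_shift fg).
    + exact: (induces_ball_shift fg').
  by have [Dx [a ->]] := bt_surj bt x; rewrite fg// fg'// kk'.
- move=> f f' g [k Dk fg] [k' Dk' fg']; apply: val_inj; apply: bijP => a.
  have kk' : k = k'.
    have [n Dn] := D0; apply: (addrI n).
    have [/(_ Dn) Dnk _] := Dk n; have [/(_ Dn) Dnk' _] := Dk' n.
    by rewrite -(bt_lev bt (val f a) Dnk) -fg// fg'// (bt_lev bt).
  apply: (bt_sep bt) => n Dn.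
  have Dnk : D (n - k) by exact/(invariantN Dk n).
  by have := fg a _ Dnk; rewrite (fg' a _ Dnk) -kk' subrK => ->.
- move=> f f' g g' [k Dk fg] [k' Dk' fg']; exists (k' + k).
    by move=> n; rewrite addrA -Dk.
  by move=> a n Dn /=; rewrite addrA fg'// fg//; apply/(Dk' n).
Qed.

End BallTree.

(** * Digits and labels *)

(* The digit [dig a (n + 1)] tells the classes of [E (n + 1)] inside the class
   of [a] for [E n] apart. *)
Record digit_space (Y : Type) (q : nat) (D : set int)
    (E : int -> Y -> Y -> Prop) (dig : Y -> int -> nat) : Prop := {
  ds_level : D !=set0;
  ds_succ : forall n, D n -> D (n + 1);
  ds_inhabited : inhabited Y;
  ds_le : forall n a b, D n -> E (n + 1) a b -> E n a b;
  ds_dig : forall n a b, D n -> E n a b ->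
    (dig a (n + 1) = dig b (n + 1) <-> E (n + 1) a b);
  ds_onto : forall n a c, D n -> (c < q)%N ->
    exists2 b, E n a b & dig b (n + 1) = c;
  ds_lt : forall n a, D n -> (dig a (n + 1)%R < q)%N;
  ds_join : forall n a b, D n -> exists2 m : nat, D (n - m%:Z) & E (n - m%:Z) a b;
  ds_sep : forall a b, (forall n, D n -> E n a b) -> a = b;
  ds_complete : forall s : int -> Y, (forall n, D n -> E n (s n) (s (n + 1))) ->
    exists a, forall n, D n -> E n a (s n)
}.

(** By [lt_inj] and [lt_join], a vertex is determined by its level and the labels met on the way up,
    as a ball is by its radius and the digits of its center. *)
Record labelled_tree (V : Type) (q : nat) (D : set int) (p : V -> V)
    (lev : V -> int) (lab : V -> nat) : Prop := {
  lt_lev : forall x, D (lev x);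
  lt_parent : forall x, D (lev x - 1) -> lev (p x) = lev x - 1;
  lt_lt : forall x, D (lev x - 1) -> (lab x < q)%N;
  lt_inj : forall x y, D (lev x - 1) -> lev x = lev y -> p x = p y ->
    lab x = lab y -> x = y;
  lt_child : forall x c, (c < q)%N ->
    exists y, [/\ p y = x, lev y = lev x + 1 & lab y = c];
  lt_join : forall x y, lev x = lev y ->
    exists2 i : nat, D (lev x - i%:Z) & iter i p x = iter i p y
}.

Section Matching.
Variables (Y V : Type) (q : nat) (D : set int).
Variables (E : int -> Y -> Y -> Prop) (dig : Y -> int -> nat).
Variables (p : V -> V) (lev : V -> int) (lab : V -> nat).
Hypothesis ds : digit_space q D E dig.
Hypothesis lt : labelled_tree q D p lev lab.

(** [x] is meant to be the vertex of the ball of level [n] around [a]: the labels read upwards from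
    [x] are the digits of [a]. At a root there is no label to compare. *)
Definition matches (x : V) (a : Y) (n : int) : Prop :=
  lev x = n /\
  forall k : nat, D (n - k%:Z - 1) -> lab (iter k p x) = dig a (n - k%:Z).

(** A starting vertex for the descent: it will be the root, or a vertex far along the ray of the
    end. *)
Hypothesis matches_base : forall a n, D n ->
  exists2 m : nat, D (n - m%:Z) & exists x, matches x a (n - m%:Z).

Lemma level_add n (m : nat) : D n -> D (n + m%:Z).
Proof.
move=> Dn; elim: m => [|m IH]; first by rewrite addr0.
have -> : n + m.+1%:Z = n + m%:Z + 1 by lia.
exact: (ds_succ ds).
Qed.

Lemma level_between m n : D m -> m <= n -> D n.
Proof.
move=> Dm mn; have -> : n = m + (absz (n - m)%R)%:Z by lia.
exact: level_add.
Qed.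

Lemma matches_parent x a n : D n -> matches x a (n + 1) -> matches (p x) a n.
Proof.
move=> Dn [xl xd]; split.
  by rewrite (lt_parent lt) xl addrK.
move=> k Dk; rewrite -iterSr.
have e : n + 1 - k.+1%:Z = n - k%:Z by lia.
by rewrite xd e.
Qed.

Lemma matches_child x a n : lev x = n + 1 -> matches (p x) a n ->
  lab x = dig a (n + 1) -> matches x a (n + 1).
Proof.
move=> xl [pl pd] xd; split=> // -[|k]; first by rewrite subr0.
have -> : n + 1 - k.+1%:Z = n - k%:Z by lia.
by rewrite iterSr; exact: pd.
Qed.

(** Descend from a common ancestor: equal parents and equal labels give equal vertices. *)
Lemma matches_inj x y a n : matches x a n -> matches y a n -> x = y.
Proof.
move=> xa ya; have [i] : exists2 i : nat, D (lev x - i%:Z) &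
    iter i p x = iter i p y by apply: (lt_join lt); rewrite xa.1 ya.1.
rewrite xa.1; elim: i n x y xa ya => [//|i IH] n x y xa ya Di xy.
have Dn1 : D (n - 1) by apply: level_between Di _; lia.
move: xa ya Dn1 Di; rewrite -[n](subrK 1); move: (n - 1) => m.
rewrite addrK => xa ya Dm Di.
have Dx : D (lev x - 1) by rewrite xa.1 addrK.
apply: (lt_inj lt) => //; first by rewrite xa.1 ya.1.
  apply: (IH m); rewrite -?iterSr//; try exact: matches_parent.
  by congr D : Di; lia.
have /= := xa.2 0%N; have /= := ya.2 0%N.
by rewrite !subr0 addrK => -> // ->.
Qed.

(** Descend from the starting vertex, choosing each time the child labelled by the next digit of
    [a]. *)
Lemma matches_exists a n : D n -> exists x, matches x a n.
Proof.
move=> Dn; have [m Dm [x xa]] := matches_base a Dn.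
rewrite -[n](subrK m%:Z); move: xa Dm; move: (n - m%:Z) => k xa Dk.
elim: m => [|m [y ya]]; first by exists x; rewrite addr0.
have Dkm := level_add m Dk.
have [z [zp zl zd]] := lt_child lt y (ds_lt ds a Dkm).
exists z; have -> : k + m.+1%:Z = k + m%:Z + 1 by lia.
by apply: matches_child; rewrite ?zp// zl ya.1.
Qed.

Lemma equiv_le n (m : nat) a b : D n -> E (n + m%:Z) a b -> E n a b.
Proof.
move=> Dn; elim: m => [|m IH]; first by rewrite addr0.
have -> : n + m.+1%:Z = n + m%:Z + 1 by lia.
by move=> /(ds_le ds (level_add m Dn)).
Qed.

Lemma matches_equiv x a b n : E n a b -> matches x a n -> matches x b n.
Proof.
move=> ab [xl xd]; split=> // k Dk; rewrite xd//.
have Eab (i : nat) : D (n - i%:Z) -> E (n - i%:Z) a b.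
  by move=> Di; apply: (@equiv_le _ i); rewrite ?subrK.
have := ds_dig ds Dk (a := a) (b := b); rewrite subrK => -[].
  have e : n - k%:Z - 1 = n - k.+1%:Z by lia.
  by rewrite e in Dk *; exact: Eab.
move=> _; apply; apply: Eab; apply: level_between Dk _; lia.
Qed.

(** Both points lie in one class at some low level, and the common digits then keep them together
    level by level. *)
Lemma equiv_matches x a b n : D n -> matches x a n -> matches x b n -> E n a b.
Proof.
move=> Dn; have [m] := ds_join ds a b Dn.
rewrite -{3 4 5}[n](subrK m%:Z); move: (n - m%:Z) => k Dk Ek.
elim: m x => [|m IH] x; first by rewrite addr0.
have -> : k + m.+1%:Z = k + m%:Z + 1 by lia.
have Dkm := level_add m Dk.
move=> xa xb; have Ekm : E (k + m%:Z) a b.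
  by apply: (IH (p x)); exact: matches_parent.
apply/(ds_dig ds Dkm Ekm).
have := xa.2 0%N; have := xb.2 0%N.
by rewrite !subr0 addrK => <- // <-.
Qed.

(** Start from any point [o] and its vertex [z] at the level of [x]. Below the common ancestor of
    [x] and [z], the digits are replaced one at a time by the labels leading to [x]. *)
Lemma matches_surj x : exists a, matches x a (lev x).
Proof.
case: (ds_inhabited ds) => o.
have [z zo] := matches_exists o (lt_lev lt x).
have [i Di xz] := lt_join lt (esym zo.1).
elim: i x z o zo Di xz => [|i IH] x z o zo Di xz.
  by exists o; move: xz zo => /= <-.
have [n ln] : exists n, lev x = n + 1 by exists (lev x - 1); rewrite subrK.
have Dn : D n by apply: level_between Di _; lia.
have lp : lev (p x) = n by rewrite (lt_parent lt) ln addrK.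
have [a] : exists a, matches (p x) a (lev (p x)).
  apply: (IH _ (p z) o); rewrite -?iterSr// lp.
    by apply: matches_parent => //; rewrite -ln.
  by congr D : Di; lia.
rewrite lp => xa; have [|b ab bd] := ds_onto ds a Dn (c := lab x).
  by apply: (lt_lt lt); rewrite ln addrK.
exists b; rewrite ln; apply: matches_child => //.
exact: matches_equiv xa.
Qed.

Lemma exists_ball_tree : (1 < q)%N -> exists beta : Y -> int -> V,
  ball_tree D p lev beta /\
  forall n a b, D n -> (beta a n = beta b n <-> E n a b).
Proof.
move=> q1; have [n0 Dn0] := ds_level ds; case: (ds_inhabited ds) => o.
have [x0 _] := matches_exists o Dn0.
have H (an : Y * int) : exists x, D an.2 -> matches x an.1 an.2.
  have [/(matches_exists an.1)[x xP]|] := pselect (D an.2); last by exists x0.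
  by exists x.
have [f fP] := choice H; pose beta a n := f (a, n).
have bm a n : D n -> matches (beta a n) a n := fP (a, n).
have bE n a b : D n -> (beta a n = beta b n <-> E n a b).
  move=> Dn; split=> [e|ab].
    by apply: (@equiv_matches (beta a n)) => //; [|rewrite e]; exact: bm.
  apply: (@matches_inj _ _ b n); last exact: bm.
  by apply: matches_equiv ab _; exact: bm.
exists beta; split=> //; split.
- exact: ds_succ ds.
- by move=> a n /(bm a)[].
- move=> x; have Dx := lt_lev lt x; split=> //.
  by have [a xa] := matches_surj x; exists a; exact: matches_inj xa (bm _ _ Dx).
- move=> a n Dn; apply: (matches_inj (a := a) (n := n)); last exact: bm.
  by apply: matches_parent => //; apply: bm; exact: (ds_succ ds).
- by move=> a b ab; apply: (ds_sep ds) => n Dn; apply/bE => //; exact: ab.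
- move=> u ul up; have [s sP] := choice (fun n => matches_surj (u n)).
  have us n : D n -> matches (u n) (s n) n by move=> Dn; rewrite -{3}(ul _ Dn).
  have [|a aP] := ds_complete ds (s := s).
    move=> n Dn; have Dn1 := ds_succ ds Dn.
    apply: (@equiv_matches (u n)) => //; first exact: us.
    by rewrite -up//; apply: matches_parent => //; exact: us.
  exists a => n Dn; apply: (matches_inj (a := s n) (n := n)); first exact: us.
  by apply: matches_equiv (aP _ Dn) _; exact: bm.
- move=> n Dn; have Dn1 := ds_succ ds Dn.
  (* Two points of one class whose next digits are 0 and 1 show that the class splits; this uses
     [1 < q]. *)
  have [a oa ad] := ds_onto ds o Dn (ltnW q1).
  have [b ob bd] := ds_onto ds a Dn q1.
  exists a, b; split; first exact/(bE n a b Dn).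
  by move=> /(bE _ _ _ Dn1)/(ds_dig ds Dn ob); rewrite ad bd.
Qed.

End Matching.

(** * Trees *)

Section TreeDistance.
Variables (V : eqType) (e : rel V).
Hypothesis te : tree e.
Implicit Types x y z w : V.

Lemma walk_cat x y z m n : walk e x y m -> walk e y z n -> walk e x z (m + n)%N.
Proof.
move=> [s [es ls ss]] [t [et lt st]]; exists (s ++ t).
by rewrite cat_path es ls et last_cat ls lt size_cat ss st.
Qed.

Lemma walk_sym x y n : walk e x y n -> walk e y x n.
Proof.
move=> [s [es ls ss]]; exists (rev (belast x s)).
rewrite size_rev size_belast -ls rev_path; split=> //.
  by rewrite (eq_path (e' := e))// => a b; rewrite (tree_sym te).
by case: s {es ls ss} => //= a s; rewrite rev_cons last_rcons.
Qed.

Lemma walk1 x y : e x y -> walk e x y 1.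
Proof. by move=> xy; exists [:: y]; rewrite /= xy. Qed.

Lemma exists_gdist x y : exists n, gdist e x y n.
Proof.
have [n0 w0] := tree_connected te x y.
have ex : exists n, `[< walk e x y n >] by exists n0; exact/asboolP.
case: (ex_minnP ex) => n /asboolP wn min; exists n; split=> // m wm.
by apply: min; exact/asboolP.
Qed.

Definition dist x y : nat := xget 0%N [set n | gdist e x y n].

Lemma gdistE x y n : gdist e x y n <-> dist x y = n.
Proof.
have [m xym] := exists_gdist x y.
have P : gdist e x y (dist x y) by exact: (xgetI 0%N xym).
split=> [[wn mn]|<-//]; apply/eqP; rewrite eqn_leq.
by rewrite P.2// mn//; exact: P.1.
Qed.

Lemma dist_walk x y : walk e x y (dist x y).
Proof. by have [] := (gdistE x y _).2 erefl. Qed.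

Lemma dist_le x y n : walk e x y n -> (dist x y <= n)%N.
Proof. by move=> xy; have [_] := (gdistE x y _).2 erefl; apply. Qed.

Lemma dist_sym x y : dist x y = dist y x.
Proof.
by apply/eqP; rewrite eqn_leq !dist_le//; apply: walk_sym; exact: dist_walk.
Qed.

Lemma dist_triangle y x z : (dist x z <= dist x y + dist y z)%N.
Proof. by apply: dist_le; apply: walk_cat; exact: dist_walk. Qed.

Lemma dist_eq0 x y : dist x y = 0%N <-> x = y.
Proof.
split=> [xy|->].
  by have [s [_ ls]] := dist_walk x y; rewrite xy => /size0nil s0; rewrite s0 in ls.
by apply/eqP; rewrite -leqn0; apply: dist_le; exists [::].
Qed.

Lemma dist_edge x y z : e x y -> (dist x z <= (dist y z).+1)%N.
Proof.
move=> xy; apply: dist_le; rewrite -add1n.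
by apply: walk_cat (dist_walk y z); exact: walk1.
Qed.

Lemma exists_closer x z : x <> z -> exists2 y, e x y & dist x z = (dist y z).+1.
Proof.
move=> xz; have [[|y s] [/= es ls ss]] := dist_walk x z => //.
move: es => /andP[xy es]; exists y => //; apply/eqP; rewrite eqn_leq dist_edge//=.
by rewrite -ss ltnS; apply: dist_le; exists s.
Qed.

(** A shortest walk from [y] through [x] would be longer than the distance from [x] to [z]. *)
Lemma geodesic_avoids x y z : e x y -> (dist y z <= dist x z)%N ->
  exists s, [/\ path e y s, last y s = z & x \notin y :: s].
Proof.
move=> xy le; have [s [es ls ss]] := dist_walk y z; exists s; split=> //.
rewrite inE negb_or; apply/andP; split.
  by apply/eqP => xyE; move: xy; rewrite xyE (tree_irr te).
apply/negP => /splitPr sx; case: sx es ls ss => s1 s2.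
rewrite cat_path last_cat /= size_cat /= => /and3P[_ _ e2] l2 sz.
have : (dist x z <= size s2)%N by apply: dist_le; exists s2.
lia.
Qed.

(* Two geodesics towards [z] that avoid [x] would close up to a cycle at [x]. *)
Lemma closer_unique x y1 y2 z : e x y1 -> e x y2 ->
  (dist y1 z <= dist x z)%N -> (dist y2 z <= dist x z)%N -> y1 = y2.
Proof.
move=> xy1 xy2 /(geodesic_avoids xy1)[s1 [e1 l1 n1]].
move=> /(geodesic_avoids xy2)[s2 [e2 l2 n2]].
(* The first geodesic followed by the reverse of the second joins [y1] to [y2] away from [x]. Made
   simple and closed up at [x], it is a cycle of length at most 2, which forces [y1 = y2]. *)
have [t [et lt nt]] : exists t,
    [/\ path e y1 t, last y1 t = y2 & x \notin y1 :: t].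
  exists (s1 ++ rev (belast y2 s2)); split.
  - rewrite cat_path e1 l1 -l2 rev_path (eq_path (e' := e))// => a b.
    by rewrite (tree_sym te).
  - rewrite last_cat l1 -l2; case: s2 {e2 l2 n2} => //= a s.
    by rewrite rev_cons last_rcons.
  - rewrite -cat_cons mem_cat (negPf n1) mem_rev.
    by apply: contra n2 => /mem_belast.
move: lt; case: (shortenP et) => s es us sub ls.
have nx : x \notin y1 :: s.
  by apply: contra nt; rewrite !inE => /orP[->//|/sub ->]; rewrite orbT.
have : cycle e [:: x, y1 & s].
  by rewrite /= rcons_path xy1 es ls (tree_sym te) xy2.
move=> /(tree_acyclic te); rewrite cons_uniq nx us => /(_ isT) /=.
by case: s ls {es us sub nx}.
Qed.

(** Equal distances are impossible: if [y] is no farther from [z] than [x], it is by [closer_unique]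
    the neighbor of [x] that is strictly closer. *)
Lemma dist_neighbor x y z : e x y ->
  dist y z = (dist x z).+1 \/ dist x z = (dist y z).+1.
Proof.
move=> xy; have yx : e y x by rewrite (tree_sym te).
have [lt|le] := ltnP (dist x z) (dist y z).
  by left; apply/eqP; rewrite eqn_leq dist_edge.
right; have [xz|xz] := eqVneq x z.
  move: le; rewrite xz (dist_eq0 z z).2// leqn0 => /eqP/(dist_eq0 y z) yz.
  by move: xy; rewrite xz yz (tree_irr te).
have [w xw wz] := exists_closer (elimN eqP xz).
by rewrite (closer_unique xy xw le)// wz.
Qed.

Lemma dist_automorphism g x y : automorphism e g -> dist (g x) (g y) = dist x y.
Proof.
move=> ga; apply/eqP; rewrite eqn_leq; apply/andP; split; apply: dist_le.
  by apply: automorphism_walk => //; exact: dist_walk.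
have := automorphism_walk (automorphismV ga) (dist_walk (g x) (g y)).
by rewrite !bijVK.
Qed.

End TreeDistance.

Lemma card_bij_at (T : Type) (A : set T) (q : nat) (x : T) : A #= `I_q -> A x ->
  exists f : T -> nat, set_bij A `I_q f /\ f x = 0%N.
Proof.
case: q => [|q] Aq Ax.
  by move: Aq; rewrite II0 card_eq0 => /eqP A0; rewrite A0 in Ax.
have /card_set_bijP[g [gf gi gs]] := Aq.
(* The transposition of 0 and [g x]. *)
pose s n := if n == g x then 0%N else if n == 0%N then g x else n.
have sK : involutive s.
  rewrite /s => n; case: (n =P g x) => [->|ne]; first by case: eqP => // ->.
  by case: (n =P 0%N) => [->|n0]; rewrite ?eqxx//; do 2 case: eqP => //.
have sq n : (n < q.+1)%N -> (s n < q.+1)%N.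
  by rewrite /s => nq; case: ifP => // _; case: ifP => // _; exact: (gf x).
exists (s \o g); split; last by rewrite /s /= eqxx.
split=> [y Ay|y z Ay Az|n nq] /=.
- exact: sq (gf y Ay).
- by move=> /(can_inj sK); exact: gi.
- by have [y Ay yn] := gs _ (sq _ nq); exists y => //; rewrite yn sK.
Qed.

Lemma card_setD1 (T : Type) (A : set T) (q : nat) (x : T) : A #= `I_q.+1 -> A x ->
  A `\ x #= `I_q.
Proof.
move=> Aq Ax; have [f [[ff fi fs] fx]] := card_bij_at Aq Ax.
apply/card_set_bijP; exists (predn \o f); have f0 y : A y -> y <> x -> (0 < f y)%N.
  move=> Ay yx; rewrite lt0n; apply/eqP => fy; apply: yx.
  by apply: fi; rewrite ?inE// fx.
split=> [y [Ay yx]|y z /set_mem[Ay yx] /set_mem[Az zx]|n nq] /=.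
- by rewrite -ltnS prednK ?f0//; exact: (ff y).
- move=> fyz; apply: fi; rewrite ?inE//.
  by rewrite -(prednK (f0 y Ay yx)) fyz prednK// f0.
- have [y Ay yn] := fs n.+1 nq; exists y; rewrite ?yn//; split=> // yx.
  by move: yn; rewrite yx fx.
Qed.

(** * Height functions, parents and children *)

Section Height.
Variables (V : eqType) (e : rel V) (D : set int) (h : V -> int).

(** Common form of the distance to a root and of the Busemann function of an end: the height drops
    by 1 towards the root or the end, in a single direction. *)
Record height_function : Prop := {
  hgt_level : forall x, D (h x);
  hgt_edge : forall x y, e x y -> h y = h x + 1 \/ h y = h x - 1;
  hgt_inj : forall x y z, e x y -> e x z -> h y = h x - 1 -> h z = h x - 1 ->
    y = z;
  hgt_lower : forall x, D (h x - 1) -> exists y, e x y /\ h y = h x - 1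
}.

Hypothesis te : tree e.
Hypothesis hf : height_function.

Definition parent_map (p : V -> V) : Prop :=
  forall x, D (h x - 1) -> e x (p x) /\ h (p x) = h x - 1.

Lemma exists_parent_map : exists p, parent_map p.
Proof.
suff H x : exists y, D (h x - 1) -> e x y /\ h y = h x - 1.
  by have [p pP] := choice H; exists p.
have [/(hgt_lower hf)[y yP]|] := pselect (D (h x - 1)); first by exists y.
by exists x.
Qed.

Variable p : V -> V.
Hypothesis pP : parent_map p.

Lemma parentE x y : e x y -> h y = h x - 1 -> p x = y.
Proof.
move=> xy yx; have Dx : D (h x - 1) by rewrite -yx; exact: hgt_level hf y.
by have [xp px] := pP Dx; exact: (hgt_inj hf xp xy).
Qed.

Definition children x : set V := [set y | e x y /\ h y = h x + 1].

Lemma mem_children x : D (h x - 1) -> children (p x) x.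
Proof.
move=> Dx; have [xp px] := pP Dx.
by rewrite /children/= (tree_sym te) xp px subrK.
Qed.

Lemma children_parent x y : children x y -> p y = x.
Proof.
move=> [xy yx]; apply: parentE; first by rewrite (tree_sym te).
by rewrite yx addrK.
Qed.

Lemma labelled_tree_of_height (q : nat) (c : V -> V -> nat) :
  (forall x, set_bij (children x) `I_q (c x)) ->
  (forall x y, h x = h y ->
    exists2 i : nat, D (h x - i%:Z) & iter i p x = iter i p y) ->
  labelled_tree q D p h (fun x => c (p x) x).
Proof.
move=> cb join; split=> //.
- exact: hgt_level hf.
- by move=> x /pP[].
- by move=> x /mem_children xc; have [cf _ _] := cb (p x); exact: cf xc.
- move=> x y Dx xy pxy; have [_ ci _] := cb (p x); rewrite -pxy => /ci; apply.
    by rewrite inE; exact: mem_children.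
  by rewrite inE pxy; apply: mem_children; rewrite -xy.
- move=> x k kq; have [_ _ cs] := cb x; have [y yc yk] := cs k kq.
  by exists y; rewrite (children_parent yc); split=> //; case: yc.
Qed.

(** The image of the parent of [x] is a neighbor of [g x] one level lower, hence its parent. *)
Lemma tree_shift_of_automorphism k g : invariant_under D k ->
  automorphism e g -> (forall x, h (g x) = h x + k) -> tree_shift D p h k g.
Proof.
move=> Dk ga gh; split=> // x Dx; have [xp px] := pP Dx.
by apply: parentE; rewrite ?ga// !gh px addrAC.
Qed.

(** Every edge joins a vertex to its parent, and [g] respects parents. *)
Lemma tree_shift_edge k g x y : invariant_under D k -> tree_shift D p h k g ->
  e x y -> e (g x) (g y).
Proof.
move=> Dk [gh gp].
have lower a b : e a b -> h b = h a - 1 -> e (g a) (g b).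
  move=> ab ba; have Db := hgt_level hf b.
  have Da : D (h (g a) - 1) by rewrite gh addrAC -ba; apply/(Dk (h b)).
  by rewrite -(parentE ab ba) -gp -?ba//; have [] := pP Da.
move=> xy; have [yx|yx] := hgt_edge hf xy; last exact: lower.
rewrite (tree_sym te); apply: lower; first by rewrite (tree_sym te).
by rewrite yx addrK.
Qed.

Lemma tree_shift_automorphism k (g : bij V) : invariant_under D k ->
  tree_shift D p h k (bij_fun g) -> automorphism e g.
Proof.
move=> Dk gk x y; apply/idP/idP; last exact: tree_shift_edge gk.
move=> /(tree_shift_edge (invariantN Dk) (tree_shiftV Dk gk)).
by rewrite !bijVK.
Qed.

End Height.

(** * The rooted tree *)

Definition nonneg : set int := [set n | 0 <= n].

Lemma rooted_tree_structure (V : eqType) (e : rel V) (r : V) (q : nat) :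
  rooted_regular_tree e r q -> exists (p : V -> V) (lev : V -> int) (lab : V -> nat),
  [/\ labelled_tree q nonneg p lev lab, lev r = 0 &
   forall g : bij V, g \in rooted_aut_pred e r <->
     exists2 k, [set 0] k & tree_shift nonneg p lev k (bij_fun g)].
Proof.
move=> [te childq]; pose h x := (dist e x r)%:Z.
have hf : height_function e nonneg h.
  split=> [x|x y xy|x y z xy xz yx zx|x Dx].
  - by rewrite /nonneg/=.
  - by rewrite /h; have := dist_neighbor te r xy; lia.
  - by apply: (closer_unique te xy xz (z := r)); move: yx zx; rewrite /h; lia.
  - have [|y xy yx] := @exists_closer _ e te x r.
      by move: Dx; rewrite /nonneg/= /h => + /(dist_eq0 te x r).2; lia.
    by exists y; split=> //; rewrite /h yx; lia.
have [p pP] := exists_parent_map hf.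
have childE x : children e h x = [set y | child e r x y].
  apply/seteqP; split=> y [xy].
    move=> yx; split=> //; exists (dist e x r).
      by apply/(gdistE te); exact: dist_sym.
    by apply/(gdistE te); rewrite dist_sym//; move: yx; rewrite /h; lia.
  move=> [n /(gdistE te) + /(gdistE te)]; rewrite ![dist e r _]dist_sym//.
  by move=> xn yn; split=> //; rewrite /h xn yn; lia.
have /choice[c cb] x : exists f : V -> nat, set_bij (children e h x) `I_q f.
  apply/card_set_bijP; rewrite childE; exact: childq.
(* The root is thus the common ancestor of any two vertices of the same level. *)
have toroot i x : dist e x r = i -> iter i p x = r.
  elim: i x => [|i IH] x xi; first exact/(dist_eq0 te).
  rewrite iterSr; apply: IH; have [|_] := pP x.
    by rewrite /nonneg/= /h xi; lia.
  by rewrite /h xi; lia.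
exists p, h, (fun x => c (p x) x).
have inv0 : invariant_under nonneg 0 by move=> n; rewrite addr0.
split; last move=> g.
- apply: (labelled_tree_of_height te hf pP) => // x y xy.
  exists (dist e x r); first by rewrite /nonneg/= /h subrr.
  rewrite !toroot//; by move: xy; rewrite /h => -[].
- by rewrite /h (dist_eq0 te r r).2.
split=> [/asboolP[ga gr]|[_ -> gk]].
  exists 0 => //; apply: (tree_shift_of_automorphism hf pP) => // x.
  by rewrite /h -{1}gr dist_automorphism// addr0.
apply/asboolP; split; first exact: (tree_shift_automorphism te hf pP) inv0 gk.
apply/(dist_eq0 te); have := gk.1 r.
by rewrite /h (dist_eq0 te r r).2// addr0 => -[].
Qed.

Lemma nonincreasing_stationary (f : nat -> nat) : (forall n, (f n.+1 <= f n)%N) ->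
  exists N, forall n, (N <= n)%N -> f n = f N.
Proof.
move=> fS; have fle m n : (m <= n)%N -> (f n <= f m)%N.
  move=> mn; rewrite -(subnK mn); elim: (n - m)%N => // k IH.
  by rewrite addSn; exact: leq_trans (fS _) IH.
have ex : exists l, `[< exists N, f N = l >] by exists (f 0%N); apply/asboolP; exists 0%N.
case: (ex_minnP ex) => l /asboolP[N fN] min; exists N => n Nn.
by apply/eqP; rewrite eqn_leq fle// fN min//; apply/asboolP; exists n.
Qed.

(** * The Busemann function of an end *)

Section Busemann.
Variables (V : eqType) (e : rel V) (v : nat -> V).
Hypothesis te : tree e.
Hypothesis vray : geodesic_ray e v.

Lemma ray_edge n : e (v n) (v n.+1).
Proof.
have [[s [es ls ss]] _] := vray (leqnSn n).
move: ss es ls; rewrite subSnn; case: s => // a [|//] _ /=.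
by rewrite andbT => ea <-.
Qed.

Lemma dist_ray m n : (m <= n)%N -> dist e (v m) (v n) = (n - m)%N.
Proof. by move=> /vray/(gdistE te). Qed.

(** Along the ray, the distance from [x] to [v n] minus [n] is nonincreasing, and it is bounded
    below by the triangle inequality; being an integer, it is eventually constant. *)
Lemma exists_busemann : exists h : V -> int, forall x,
  exists N, forall n, (N <= n)%N -> (dist e x (v n))%:Z - n%:Z = h x.
Proof.
suff H x : exists l : int, exists N, forall n, (N <= n)%N ->
    (dist e x (v n))%:Z - n%:Z = l.
  by have [h hP] := choice H; exists h.
(* The added constant makes the difference nonnegative, so that truncated subtraction is exact. *)
pose f n := (dist e x (v n) + dist e x (v 0%N) - n)%N.
have fge n : (n <= dist e x (v n) + dist e x (v 0%N))%N.
  rewrite -[X in (X <= _)%N]subn0 -(dist_ray (leq0n n)) addnC.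
  by rewrite [dist e x (v 0%N)]dist_sym// dist_triangle.
have [n|N NP] := @nonincreasing_stationary f.
  have := fge n; have := fge n.+1; rewrite /f.
  have := dist_edge te (v n.+1) (x := x) (y := x).
  have := @dist_edge _ e te (v n.+1) (v n) x; rewrite (tree_sym te) ray_edge.
  by move=> /(_ isT); rewrite ![dist e (v _) x]dist_sym//; lia.
exists ((dist e x (v N))%:Z - N%:Z), N => n Nn.
by have := NP n Nn; have := fge n; have := fge N; rewrite /f; lia.
Qed.

Variable h : V -> int.
Hypothesis hP : forall x,
  exists N, forall n, (N <= n)%N -> (dist e x (v n))%:Z - n%:Z = h x.

Lemma busemann_le x n : h x <= (dist e x (v n))%:Z - n%:Z.
Proof.
have [N NP] := hP x; rewrite -(NP (maxn N n)) ?leq_maxl//.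
have := @dist_triangle _ e te (v n) x (v (maxn N n)).
by rewrite dist_ray ?leq_maxr//; have := leq_maxr N n; lia.
Qed.

Lemma busemann_edge x y : e x y -> h y = h x + 1 \/ h y = h x - 1.
Proof.
move=> xy; have [N NP] := hP x; have [M MP] := hP y.
rewrite -(NP (maxn N M)) ?leq_maxl// -(MP (maxn N M)) ?leq_maxr//.
by have := dist_neighbor te (v (maxn N M)) xy; lia.
Qed.

(** A step towards [v n] lowers the bound of [busemann_le] to [h x - 1], and [h] changes by exactly
    1 along an edge. *)
Lemma busemann_closer x y n : e x y -> h x = (dist e x (v n))%:Z - n%:Z ->
  dist e x (v n) = (dist e y (v n)).+1 ->
  h y = h x - 1 /\ h y = (dist e y (v n))%:Z - n%:Z.
Proof.
move=> xy hx d; have := busemann_edge xy; have := busemann_le y n; lia.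
Qed.

Lemma busemann_ray n : h (v n) = - n%:Z.
Proof.
have [N NP] := hP (v n).
by rewrite -(NP (maxn N n)) ?leq_maxl// dist_ray ?leq_maxr//; have := leq_maxr N n; lia.
Qed.

(** For large [n], the lower neighbors of [x] are those closer to [v n], so [closer_unique] leaves
    only one. *)
Lemma busemann_height : height_function e setT h.
Proof.
split=> // [|x y z xy xz yx zx|x _]; first exact: busemann_edge.
  have [N NP] := hP x; have [M MP] := hP y; have [L LP] := hP z.
  pose n := maxn N (maxn M L); apply: (closer_unique te xy xz (z := v n)).
    have := NP n (leq_maxl _ _); have := MP n _; rewrite /n; lia.
  have := NP n (leq_maxl _ _); have := LP n _; rewrite /n; lia.
(* A closer neighbor exists only if [x] is not the target itself, so two consecutive targets are
   kept available. *)
have [N NP] := hP x; have xNn : x <> v N \/ x <> v N.+1.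
  have [xv|] := eqVneq x (v N); last by left; apply/eqP.
  right=> xv'; have := ray_edge N; by rewrite -xv -xv' (tree_irr te).
have [n [nN xn]] : exists n, (N <= n)%N /\ x <> v n.
  by case: xNn => ?; [exists N | exists N.+1].
have [y xy yx] := exists_closer te xn; exists y; split=> //.
by have [] := busemann_closer xy (esym (NP n nN)) yx.
Qed.

Variable p : V -> V.
Hypothesis pP : parent_map e setT h p.

Lemma parent_ray n : p (v n) = v n.+1.
Proof.
apply: (parentE busemann_height pP (ray_edge n)).
by rewrite !busemann_ray; lia.
Qed.

Lemma iter_parent_ray i n : iter i p (v n) = v (n + i)%N.
Proof. by elim: i => [|i IH]; rewrite ?addn0// iterS IH parent_ray addnS. Qed.

(** With [N] in the stationary range, each step of a geodesic from [x] to [v N] lowers [h], so it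
    goes to the parent. *)
Lemma reach_ray x : exists i j, iter i p x = v j.
Proof.
have [N /(_ N (leqnn N)) NP] := hP x; exists (dist e x (v N)), N.
move: NP; move E : (dist e x (v N)) => i.
elim: i x E => [|i IH] x E hx; first exact/(dist_eq0 te).
have xv : x <> v N by move=> /(dist_eq0 te x _).2; rewrite E.
have [y xy] := exists_closer te xv; rewrite E => -[yi].
have [||hy hyN] := busemann_closer xy (n := N); rewrite ?E -?yi//.
rewrite iterSr (parentE busemann_height pP xy hy); apply: IH => //.
by rewrite -yi in hyN.
Qed.

Lemma level_iter i x : h (iter i p x) = h x - i%:Z.
Proof.
elim: i => [|i IH]; first by rewrite subr0.
by rewrite iterS (pP _).2// IH; lia.
Qed.

(** After [i + k] steps both vertices have reached the ray, where the level determines the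
    vertex. *)
Lemma busemann_join x y : h x = h y ->
  exists2 i : nat, setT (h x - i%:Z) & iter i p x = iter i p y.
Proof.
move=> xy; have [i [j xj]] := reach_ray x; have [k [l yl]] := reach_ray y.
exists (i + k)%N => //; rewrite iterD -iterD addnC iterD xj addnC iterD yl.
rewrite !iter_parent_ray; congr v.
have := level_iter i x; have := level_iter k y; rewrite xj yl !busemann_ray; lia.
Qed.

Lemma busemann_shift g (k : int) (N : nat) : automorphism e g ->
  (forall n : nat, (N <= n)%N -> exists2 m : nat, m%:Z = n%:Z - k & g (v n) = v m) ->
  tree_shift setT p h k (bij_fun g).
Proof.
move=> ga gv; apply: (tree_shift_of_automorphism busemann_height pP) => // x.
have [M MP] := hP x; have [L LP] := hP (g x).
(* The term [absz k] ensures that [m = n - k] is also in the stationary range of [g x]. *)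
pose n := (maxn N (maxn M L) + absz k)%N.
have [|m mk gm] := gv n; first by rewrite /n; lia.
rewrite -(MP n); last by rewrite /n; lia.
by rewrite -(LP m) -?gm ?(dist_automorphism te)//; move: mk; rewrite /n; lia.
Qed.

(** [g] commutes with parents, and the ancestors of [g (v 0)] eventually run along the ray; levels
    give the offset. *)
Lemma shift_ray (g : bij V) k : tree_shift setT p h k (bij_fun g) ->
  exists N, forall n : nat, (N <= n)%N ->
    exists2 m : nat, m%:Z = n%:Z - k & g (v n) = v m.
Proof.
move=> [gh gp]; have [i [j ij]] := reach_ray (g (v 0%N)).
have gi x s : iter s p (g x) = g (iter s p x).
  by elim: s => // s IH; rewrite !iterS IH gp.
exists i => n ni; have hn : g (v n) = v (j + (n - i))%N.
  rewrite -iter_parent_ray -ij -iterD subnK// gi iter_parent_ray//.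
exists (j + (n - i))%N => //.
by have := gh (v n); rewrite hn !busemann_ray; lia.
Qed.

End Busemann.

Lemma end_tree_structure (V : eqType) (e : rel V) (omega : set (nat -> V))
    (v : nat -> V) (q : nat) :
  (0 < q)%N -> regular_tree e q.+1 -> is_end e omega -> omega v ->
  exists (p : V -> V) (lev : V -> int) (lab : V -> nat),
  [/\ labelled_tree q setT p lev lab,
   forall n i, [/\ lev (v n) = - n%:Z, lab (v n) = 0%N & iter i p (v n) = v (n + i)%N],
   forall g : bij V, g \in end_aut0_pred e v <->
     exists2 k, [set 0] k & tree_shift setT p lev k (bij_fun g) &
   forall g : bij V, g \in end_aut_pred e omega <->
     exists2 k, setT k & tree_shift setT p lev k (bij_fun g)].
Proof.
move=> q0 [te nbq] oe ov.
have vray : geodesic_ray e v by case: oe ov => u _ -> [].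
have [h hP] := exists_busemann te vray.
have hf := busemann_height te vray hP.
have [p pP] := exists_parent_map hf.
have hv := busemann_ray te vray hP.
(* Of the [q + 1] neighbors, exactly one is the parent. *)
have childq x : children e h x #= `I_q.
  have [xp px] := pP x I.
  suff -> : children e h x = [set y | e x y] `\ p x by exact: card_setD1.
  apply/seteqP; split=> y [xy] /= hy; split=> //.
    by move=> yp; move: hy; rewrite yp px; lia.
  have [//|hy'] := hgt_edge hf xy.
  by case: hy; rewrite (parentE hf pP xy hy').
(* A child on the ray receives the label 0, so that the ray can represent the balls around 0, all of
   whose digits are 0. Levels differ along the ray, so each vertex has at most one such child. *)
have /choice[c cb] x : exists f : V -> nat, set_bij (children e h x) `I_q f /\
    forall n, children e h x (v n) -> f (v n) = 0%N.
  have [[n xn]|nx] := pselect (exists n, children e h x (v n)).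
    have [f [fb fn]] := card_bij_at (childq x) xn; exists f; split=> // m xm.
    by have -> : m = n by case: xn xm => _ + [_]; rewrite !hv; lia.
  have /card_set_bijP[f fb] := childq x; exists f; split=> // n xn.
  by case: nx; exists n.
have invT k : invariant_under setT k by [].
exists p, h, (fun x => c (p x) x); split.
- apply: (labelled_tree_of_height te hf pP (fun x => (cb x).1)).
  exact: (busemann_join te vray hP pP).
- move=> n i; split=> //; last exact: (iter_parent_ray te vray hP pP).
  by apply: (cb _).2; exact: (mem_children te pP).
- move=> g; split=> [/asboolP[ga [N gN]]|[_ -> gk]].
    exists 0 => //; apply: (busemann_shift te vray hP pP (N := N)) => // n Nn.
    by exists n; rewrite ?subr0// gN.
  apply/asboolP; split; first exact: (tree_shift_automorphism te hf pP) (invT 0) gk.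
  have [N NP] := shift_ray te vray hP pP gk; exists N => n /NP[m].
  by rewrite subr0 => -[->].
- move=> g; split=> [/asboolP[ga gW]|[k _ gk]].
    have [N [k Nk]] := (fixes_endP oe ov ga).1 gW.
    exists k => //; apply: (busemann_shift te vray hP pP (N := absz N)) => // n Nn.
    by apply: Nk; lia.
  have ga : automorphism e g := tree_shift_automorphism te hf pP (invT k) gk.
  apply/asboolP; split=> //; apply/(fixes_endP oe ov ga).
  have [N NP] := shift_ray te vray hP pP gk.
  by exists N%:Z, k => n Nn; apply: NP; lia.
Qed.

(** * Valued fields *)

Section ValuedField.
Variable K : valuedField.
Local Notation v := (valuation K).
Local Notation q := (residue_card K).
Implicit Types a b x y : K.

Lemma valuationV x : x != 0 -> v x^-1 = - v x.
Proof.
move=> x0; have := valuationM (valuationP K) x0 (invr_neq0 x0).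
by rewrite divff// valuation1; lia.
Qed.

(* With the convention v(0) = oo. *)
Definition val_ge (n : int) x : Prop := x = 0 \/ n <= v x.

Lemma val_geE n x : x != 0 -> val_ge n x <-> n <= v x.
Proof. by move=> /eqP x0; split=> [[/x0|]|]//; right. Qed.

Lemma val_ge_le m n x : m <= n -> val_ge n x -> val_ge m x.
Proof. by move=> mn [->|nx]; [left|right; exact: le_trans nx]. Qed.

Lemma val_geD n x y : val_ge n x -> val_ge n y -> val_ge n (x + y).
Proof.
have [->|x0] := eqVneq x 0; first by rewrite add0r.
have [->|y0] := eqVneq y 0; first by rewrite addr0.
have [->|xy0] := eqVneq (x + y) 0; first by left.
rewrite !val_geE// => nx ny; apply: le_trans (valuationD (valuationP K) x0 y0 xy0).
by rewrite le_min nx.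
Qed.

Lemma val_geN n x : val_ge n (- x) <-> val_ge n x.
Proof.
rewrite /val_ge valuationN; split=> -[|]; try by right.
  by move=> /eqP; rewrite oppr_eq0 => /eqP; left.
by move=> ->; left; rewrite oppr0.
Qed.

Lemma val_geM m n x y : val_ge m x -> val_ge n y -> val_ge (m + n) (x * y).
Proof.
have [->|x0] := eqVneq x 0; first by rewrite mul0r; left.
have [->|y0] := eqVneq y 0; first by rewrite mulr0; left.
rewrite !val_geE ?mulf_neq0// (valuationM (valuationP K))//; lia.
Qed.

(** The elements of positive valuation form an ideal containing every proper ideal, in particular
    the maximal one; it omits 1, so the two coincide. *)
Lemma maximal_idealE x : vf_max K x <-> val_ge 1 x.
Proof.
have [mid mneq mmax] := vf_maxP K.
have idl : valuation_ideal v (val_ge 1).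
  split; [by move=> a; apply: val_ge_le|by left|by move=> a b; exact: val_geD|].
  by move=> a b a0 b1; rewrite -(add0r 1); exact: val_geM.
have sub : vf_max K `<=` val_ge 1.
  move=> y my; have [y0|y0] := eqVneq y 0; first by left.
  have [->|oy] := ideal_sub mid my; first by left.
  right; rewrite leNgt; apply/negP => y1; apply: mneq; apply/seteqP.
  split; first exact: ideal_sub mid.
  (* If [v y <= 0] then [a / y] is an integer, and [m] would absorb every integer [a]. *)
  move=> a Oa; rewrite -[a](mulfVK y0); apply: (idealM mid) => //.
  apply: (@val_geM 0 0) => //.
  by right; rewrite valuationV//; lia.
have [<-//|e] := mmax _ idl sub.
have : val_ge 1 (1 : K) by rewrite e; right; rewrite valuation1.
by rewrite val_geE ?oner_neq0// valuation1.
Qed.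

(** A numbering of the residue field, composed with reduction and arranged to send the class of 0 to
    0. *)
Lemma exists_residue_map : exists res : K -> nat, [/\ res 0 = 0%N,
  forall x, val_ge 0 x -> (res x < q)%N,
  forall x y, val_ge 0 x -> val_ge 0 y -> (res x = res y <-> val_ge 1 (x - y)) &
  forall c, (c < q)%N -> exists2 x, val_ge 0 x & res x = c].
Proof.
pose C a : set K := [set a + x | x in vf_max K].
have RC a : val_ge 0 a -> residue_field v (vf_max K) (C a) by move=> Oa; exists a.
have R0 : val_ge 0 (0 : K) by left.
have [f [[ff fi fs] f0]] := card_bij_at (residue_cardP K) (RC 0 R0).
have CE a b : C a = C b <-> val_ge 1 (a - b).
  split=> [e|ab].
    have : C b a by rewrite -e; exists 0; [by apply/maximal_idealE; left|rewrite addr0].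
    by move=> [x /maximal_idealE mx <-]; rewrite addrAC subrr add0r.
  have sub c d : val_ge 1 (c - d) -> C c `<=` C d.
    move=> cd _ [x /maximal_idealE mx <-]; exists (c - d + x); last by rewrite addrCA addrA subrK.
    by apply/maximal_idealE; exact: val_geD.
  apply/seteqP; split; apply: sub => //.
  by apply/val_geN; rewrite opprB.
exists (f \o C); split=> //= [x Ox|x y Ox Oy|c cq].
- exact: (ff _ (RC x Ox)).
- split=> [fxy|/CE -> //]; apply/CE; apply: fi fxy; rewrite inE; exact: RC.
- by have [_ [a Oa <-] ac] := fs c cq; exists a.
Qed.

(** Lying in a common ball of radius q^-n. *)
Definition close (n : int) a b : Prop := val_ge n (a - b).

Lemma close_refl n a : close n a a. Proof. by left; rewrite subrr. Qed.

Lemma close_sym n a b : close n a b -> close n b a.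
Proof. by move=> /val_geN; rewrite opprB. Qed.

Lemma close_trans n a b c : close n a b -> close n b c -> close n a c.
Proof. by move=> ab /(val_geD ab); rewrite addrA subrK. Qed.

Lemma close_le m n a b : m <= n -> close n a b -> close m a b.
Proof. exact: val_ge_le. Qed.

Lemma close_class n a b : close n a b -> close n a = close n b.
Proof.
move=> ab; apply/seteqP; split=> c; last exact: close_trans.
by apply: close_trans; exact: close_sym.
Qed.

(** Taking 0 as representative of its own ball makes all digits of 0 vanish. *)
Lemma exists_representative (n : int) : exists r : K -> K, [/\ r 0 = 0,
  forall a, close n a (r a) & forall a b, close n a b -> r a = r b].
Proof.
pose r a := if `[< close n a 0 >] then 0 else xget 0 (close n a).
exists r; split=> [|a|a b ab].
- by rewrite /r asboolT//; exact: close_refl.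
- rewrite /r; case: asboolP => // _; apply: xgetI; exact: close_refl.
- by rewrite /r (close_class ab).
Qed.

(** The digit of [a] at level [n + 1] is the residue of [(a - r n a) / u n], where [r n a]
    represents the ball of level [n] around [a] and [u n] has valuation [n]. *)
Lemma exists_digits : exists dig : K -> int -> nat, [/\
  forall n, dig 0 n = 0%N,
  forall n a b, close n a b -> (dig a (n + 1) = dig b (n + 1) <-> close (n + 1) a b),
  forall n a c, (c < q)%N -> exists2 b, close n a b & dig b (n + 1) = c &
  forall n a, (dig a n < q)%N].
Proof.
have [res [res0 res_lt res_eq res_onto]] := exists_residue_map.
have [r rP] := choice exists_representative.
have /choice[u uP] n : exists a : K, a != 0 /\ v a = n.
  by have [a] := valuation_surj (valuationP K) n; exists a.
have scale m n x : val_ge m (x / u n) <-> val_ge (m + n) x.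
  have [un0 un] := uP n.
  have [->|x0] := eqVneq x 0; first by rewrite mul0r; split=> _; left.
  rewrite !val_geE ?mulf_neq0 ?invr_neq0// (valuationM (valuationP K)) ?invr_neq0//.
  rewrite valuationV// un; lia.
have rint n a : val_ge 0 ((a - r n a) / u n).
  by apply/scale; rewrite add0r; have [_ + _] := rP n; exact.
exists (fun a n => res ((a - r (n - 1) a) / u (n - 1))); split=> [n|n a b|n a c cq|n a].
- by have [-> _ _] := rP (n - 1); rewrite subrr mul0r.
- rewrite addrK => ab; rewrite res_eq// -mulrBl.
  have [_ _ /(_ a b ab) ->] := rP n.
  by rewrite opprB addrA subrK /close [n + 1]addrC; exact: scale.
(* The required point is the representative plus [x * u n], where [x] has residue number [c]. *)
- have [x Ox xc] := res_onto c cq; have [un0 un] := uP n.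
  have [_ ar rr] := rP n; pose b := r n a + x * u n.
  have br : close n b (r n a).
    by rewrite /close /b addrAC subrr add0r -[n in val_ge n]add0r; apply/scale; rewrite mulfK.
  have ab : close n a b by apply: close_trans (ar a) _; exact: close_sym.
  exists b => //; rewrite addrK -(rr a b ab) /b addrAC subrr add0r mulfK//.
- exact: res_lt.
Qed.

Lemma close_sep a b : (forall n, 0 <= n -> close n a b) -> a = b.
Proof.
move=> ab; apply/eqP; rewrite -subr_eq0; apply/eqP.
have [->//|ab0] := eqVneq (a - b) 0.
by have := ab (`|v (a - b)| + 1) ltac:(lia); rewrite /close val_geE//; lia.
Qed.

Lemma close_join n a b : exists m : nat, close (n - m%:Z) a b.
(* If [a = b], the valuation is a junk value, but the inequality holds for any integer there. *)
Proof. by exists (absz (n - v (a - b))%R); right; lia. Qed.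

End ValuedField.

(** * Distances in terms of balls *)

Section ValuationDistance.
Variables (R : realType) (K : valuedField).
Local Notation v := (valuation K).
Local Notation q := (residue_card K).

Let q1 : (1 : R) < q%:R. Proof. by rewrite ltr1n residue_card_gt1. Qed.
Let q0 : (0 : R) < q%:R. Proof. exact: lt_trans ltr01 q1. Qed.

Lemma vdistE (a b : K) : a <> b -> vdist R a b = q%:R ^ (- v (a - b)).
Proof. by move=> /eqP ab; rewrite /vdist (negPf ab). Qed.

Lemma close_vdist n (a b : K) : vdist R a b < q%:R ^ (- n) -> close n a b.
Proof.
have [->|ab] := eqVneq a b; first by move=> _; exact: close_refl.
rewrite vdistE; last exact/eqP.
by rewrite ltr_eXz2l// ltrN2 => nv; right; exact: ltW.
Qed.

Lemma vdist_close n (a b : K) : close n a b -> vdist R a b <= q%:R ^ (- n).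
Proof.
have [->|ab] := eqVneq a b; first by rewrite /vdist eqxx exprz_ge0// ltW.
rewrite /close val_geE ?subr_eq0// => nv.
by rewrite vdistE; [rewrite ler_eXz2l// lerN2|exact/eqP].
Qed.

(** Scaling a distance by q^-k means adding [k] to the valuation of the difference. Conversely, the
    levels [v (a - b)] and [v (a - b) + 1], both in [D], pin down the valuation of [a' - b']. *)
Lemma vdist_shift (D : set int) (k : int) (a b a' b' : K) :
  (forall m n, D m -> m <= n -> D n) -> (a <> b -> D (v (a - b))) ->
  (a = b <-> a' = b') ->
  vdist R a' b' = q%:R ^ (- k) * vdist R a b <->
  forall n, D n -> (close n a b <-> close (n + k) a' b').
Proof.
move=> Dle Dab eqs; have [ab|/eqP ab] := eqVneq a b.
  rewrite -(eqs.1 ab) -ab /vdist !eqxx mulr0.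
  by split=> // _ n _; split=> _; exact: close_refl.
have ab' : a' <> b' by move=> /eqs.
rewrite !vdistE// -expfzDr ?gt_eqF// -opprD /close.
have ab0 : a - b != 0 by rewrite subr_eq0; apply/eqP.
have ab0' : a' - b' != 0 by rewrite subr_eq0; apply/eqP.
split=> [e n Dn|H].
  rewrite !val_geE//; have -> : v (a' - b') = k + v (a - b).
    by apply: oppr_inj; apply: ieexprIz e; rewrite ?gt_eqF.
  by split; lia.
have Dv := Dab ab; have Dv1 : D (v (a - b) + 1) by apply: Dle Dv _; lia.
have := H _ Dv; have := H _ Dv1; rewrite !val_geE// => h1 h2.
by congr (_ ^ (- _)); lia.
Qed.

End ValuationDistance.

Lemma lipschitz_continuous (R : realType) (Y : metricType R) (f : Y -> Y) (l : R) :
  0 < l -> (forall x y, mdist (f x) (f y) = l * mdist x y) -> continuous f.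
Proof.
move=> l0 fl x; apply/cvg_ballP => eps e0; near=> y.
rewrite ballEmdist /= fl -ltr_pdivlMl//.
have : ball x (l^-1 * eps) y by near: y; apply: nbhsx_ballx; rewrite mulr_gt0 ?invr_gt0.
by rewrite ballEmdist.
Unshelve. all: by end_near. Qed.

(** * Completeness, isometries and dilations of a local field *)

Section LocalField.
Variables (R : realType) (F : localField R).
Local Notation q := (residue_card F).

Lemma close_complete (t : nat -> F) : (forall n : nat, close n%:Z (t n) (t n.+1)) ->
  exists a, forall n : nat, close n%:Z a (t n).
Proof.
move=> ts; have q1 : (1 : R) < q%:R by rewrite ltr1n residue_card_gt1.
have tle m n : (m <= n)%N -> close m%:Z (t m) (t n).
  move=> mn; rewrite -(subnK mn); elim: (n - m)%N => [|k IH]; first exact: close_refl.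
  by apply: close_trans IH _; rewrite addSn; apply: close_le (ts _); lia.
pose T : nat -> vspace R F := t.
have small (r : R) : 0 < r -> exists n : nat, q%:R ^ (- n%:Z) < r.
  (* The bound satisfies [r^-1 < 2 ^ n], and [q] is at least 2. *)
  move=> r0; exists (Num.bound r^-1); set n := Num.bound _.
  have qn : r^-1 < q%:R ^+ n.
    apply: lt_le_trans (upper_nthrootP (leqnn _)) _.
    by rewrite lerXn2r ?nnegrE ?ler0n// ler_nat residue_card_gt1.
  rewrite -invr_expz invf_plt ?posrE//.
  by rewrite exprz_gt0// (lt_trans ltr01).
have cT : cauchy (T @ \oo).
  apply: cauchy_exP => eps e0; have [n ne] := small _ e0.
  exists (T n), n => // m /= nm; rewrite ballEmdist /=.
  by apply: le_lt_trans ne; apply: vdist_close; exact: tle.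
have /cvg_ex[a Ta] : cvg (T @ \oo) by apply: lf_complete.
exists a => n; move/cvg_ballP : Ta => /(_ (q%:R ^ (- n%:Z))) /(_ _)[].
  by rewrite exprz_gt0// (lt_trans ltr01).
move=> N _ NP; have := NP (maxn N n) (leq_maxl _ _).
rewrite ballEmdist /= => /close_vdist an; apply: close_trans an _.
by apply: close_sym; apply: tle; exact: leq_maxr.
Qed.

(** The nonnegative levels give the limit; at a negative level [n], the point [s n] is already close
    to [s 0]. *)
Lemma close_complete_int (s : int -> F) : (forall n, close n (s n) (s (n + 1))) ->
  exists a, forall n, close n a (s n).
Proof.
move=> sS; have [|a aP] := @close_complete (fun n => s n%:Z).
  by move=> n; have -> : n.+1%:Z = n%:Z + 1 by lia.
exists a => n; have up (m : nat) : close n (s n) (s (n + m%:Z)).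
  elim: m => [|m IH]; first by rewrite addr0; exact: close_refl.
  apply: close_trans IH _; have -> : n + m.+1%:Z = n + m%:Z + 1 by lia.
  by apply: close_le (sS _); lia.
have [n0|n0] := lerP 0 n; first by have := aP (absz n); have -> : (absz n)%:Z = n by lia.
have := up (absz n); have -> : n + (absz n)%:Z = 0%N%:Z by lia.
move=> /close_sym; apply: close_trans; apply: close_le (aP 0%N); lia.
Qed.

Lemma digit_space_field dig :
  (forall n (a b : F), close n a b ->
    (dig a (n + 1) = dig b (n + 1) <-> close (n + 1) a b)) ->
  (forall n a c, (c < q)%N -> exists2 b, close n a b & dig b (n + 1) = c) ->
  (forall n a, (dig a n < q)%N) ->
  digit_space q setT (@close F : int -> vspace R F -> vspace R F -> Prop) dig.
Proof.
move=> digE dig_onto dig_lt; split=> //.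
- by exists 0.
- by split; exact: 0.
- by move=> n a b _; apply: close_le; lia.
- by move=> n a b _; exact: digE.
- by move=> n a c _; exact: dig_onto.
- by move=> n a b _; have [m] := close_join n a b; exists m.
- by move=> a b ab; apply: close_sep => n _; exact: ab.
- move=> s sS; have [a aP] := @close_complete_int s (fun n => sS n I).
  by exists a => n _; exact: aP.
Qed.

Local Notation O := (set_type (ring_of_integers R F)).

Definition close_integers (n : int) (a b : O) : Prop :=
  close n (set_val a : F) (set_val b : F).

Lemma integer_close0 (a : F) : close 0 a 0 <-> ring_of_integers R F a.
Proof. by rewrite /close subr0. Qed.

Lemma integers_close (a b : O) : close_integers 0 a b.
Proof.
have H (c : O) : close 0 (set_val c : F) 0 by apply/integer_close0; exact: set_valP.
by apply: close_trans (H a) _; apply: close_sym; exact: H.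
Qed.

Lemma digit_space_integers dig :
  (forall n (a b : F), close n a b ->
    (dig a (n + 1) = dig b (n + 1) <-> close (n + 1) a b)) ->
  (forall n a c, (c < q)%N -> exists2 b, close n a b & dig b (n + 1) = c) ->
  (forall n a, (dig a n < q)%N) ->
  digit_space q nonneg close_integers (fun a : O => dig (set_val a)).
Proof.
move=> digE dig_onto dig_lt; split=> //.
- by exists 0; rewrite /nonneg/=.
- by move=> n; rewrite /nonneg/=; lia.
- split; exists (0 : F); rewrite inE; apply/integer_close0; exact: close_refl.
- by move=> n a b _; apply: close_le; lia.
- by move=> n a b _; exact: digE.
- move=> n a c n0 cq; have [b ab bc] := dig_onto n (set_val a) c cq.
  have Ob : ring_of_integers R F b.
    (* A point close to an integer at a nonnegative level is an integer. *)
    apply/integer_close0; apply: close_trans (close_sym (close_le n0 ab)) _.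
    by apply/integer_close0; exact: set_valP.
  by exists (SigSub (mem_set Ob)).
- move=> n a b n0; exists (absz n); have -> : n - (absz n)%:Z = 0.
  + by move: n0; rewrite /nonneg/=; lia.
  + by rewrite /nonneg/=.
  + by move: n0; rewrite /nonneg/=; lia.
  + exact: integers_close.
- by move=> a b ab; apply: val_inj; apply: (@close_sep F) => n; exact: ab.
(* At negative levels the sequence is replaced by [s 0]; all integers are close there. *)
- move=> s sS; pose t n : F := set_val (s (if 0 <= n then n else 0)).
  have [n|a aP] := @close_complete_int t.
    have [n0|n0] := lerP 0 n.
      by rewrite /t n0 addr_ge0//; exact: sS.
    apply: (@close_le _ _ 0); first exact: ltW.
    exact: integers_close.
  have Oa : ring_of_integers R F a.
    apply/integer_close0; apply: close_trans (aP 0) _.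
    by apply/integer_close0; exact: set_valP.
  exists (SigSub (mem_set Oa)) => n n0.
  by have := aP n; rewrite /t ifT.
Qed.

Lemma isometry_close (f : bij (vspace R F)) : f \in @isometry_pred R (vspace R F) <->
  exists2 k, [set 0] k &
    forall a b n, setT n -> (close n a b <-> close (n + k) (f a) (f b)).
Proof.
have fE a b : a = b <-> f a = f b.
  by split=> [->//|]; exact: (can_inj (bij_funK f)).
have shiftE a b := vdist_shift R (D := setT) 0 (fun _ _ _ _ => I)
  (fun=> I) (fE a b).
split=> [/asboolP fi|[_ -> H]].
  exists 0 => // a b; apply/shiftE.
  by rewrite oppr0 expr0z mul1r; exact: fi.
apply/asboolP => x y; have := (shiftE x y).2.
by rewrite oppr0 expr0z mul1r; apply => n Dn; exact: H.
Qed.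

Lemma isometry_integers_close (f : bij O) : f \in @isometry_pred R O <->
  exists2 k, [set 0] k & forall a b n, nonneg n ->
    (close_integers n a b <-> close_integers (n + k) (f a) (f b)).
Proof.
have fE a b : set_val a = set_val b <-> set_val (f a) = set_val (f b).
  split=> [/val_inj ->//|/val_inj]; by move=> /(can_inj (bij_funK f)) ->.
have Dle m n : nonneg m -> m <= n -> nonneg n by exact: le_trans.
have DO (a b : O) : set_val a <> set_val b ->
    nonneg (valuation F (set_val a - set_val b)).
  move=> /eqP ab; have := integers_close a b.
  by rewrite /close_integers /close val_geE// subr_eq0.
have shiftE a b := vdist_shift R 0 Dle (DO a b) (fE a b).
split=> [/asboolP fi|[_ -> H]].
  exists 0 => // a b; apply/shiftE.
  by rewrite oppr0 expr0z mul1r; exact: fi.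
apply/asboolP => x y; have := (shiftE x y).2.
by rewrite oppr0 expr0z mul1r; apply => n Dn; exact: H.
Qed.

(** Since 0 and 1 are at distance 1, the distance between their images is the ratio, hence a power
    of [q]. Conversely, scaling by a positive ratio makes [f] and its inverse continuous. *)
Lemma dilation_close (f : bij (vspace R F)) : f \in @dilation_pred R (vspace R F) <->
  exists2 k, setT k &
    forall a b n, setT n -> (close n a b <-> close (n + k) (f a) (f b)).
Proof.
have fE a b : a = b <-> f a = f b.
  by split=> [->//|]; exact: (can_inj (bij_funK f)).
have shiftE k a b := vdist_shift R (D := setT) k (fun _ _ _ _ => I)
  (fun=> I) (fE a b).
have n10 : (1 : F) <> 0 by apply/eqP; exact: oner_neq0.
split=> [/asboolP[_ [l l0 fl]]|[k _ H]].
  pose k := valuation F ((f (1 : F) : F) - (f (0 : F) : F)); exists k => // a b.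
  apply/shiftE; have -> : q%:R ^ (- k) = l; last exact: fl.
  have := fl (1 : F) (0 : F); rewrite !vspace_mdistE !vdistE.
  - by move=> ->; rewrite subr0 valuation1 oppr0 expr0z mulr1.
  - exact: n10.
  - by move=> /(fE _ _).2 /n10.
have q0 : 0 < q%:R :> R by rewrite ltr0n; apply: ltnW; exact: residue_card_gt1.
have fk a b : mdist (f a) (f b) = q%:R ^ (- k) * mdist a b.
  by apply/shiftE => n Dn; exact: H.
apply/asboolP; split; last by exists (q%:R ^ (- k)); first exact: exprz_gt0.
split; first by apply: lipschitz_continuous fk; exact: exprz_gt0.
apply: (@lipschitz_continuous _ _ _ (q%:R ^ k)); first exact: exprz_gt0.
move=> x y; rewrite -{2}(bijKV f x) -{2}(bijKV f y) fk mulrA -expfzDr ?gt_eqF//.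
by rewrite subrr expr0z mul1r.
Qed.

End LocalField.

(** * The three isomorphisms *)

Lemma ball_shiftE (Y V : Type) (D : set int) (E : int -> Y -> Y -> Prop)
    (beta : Y -> int -> V) (f : Y -> Y) (k : int) :
  invariant_under D k ->
  (forall n a b, D n -> (beta a n = beta b n <-> E n a b)) ->
  ball_shift D beta k f <->
  forall a b n, D n -> (E n a b <-> E (n + k) (f a) (f b)).
Proof.
move=> Dk bE; split=> H a b n Dn.
  by rewrite -bE// -bE; [exact: H|apply/(Dk n)].
by rewrite !bE//; [exact: H|apply/(Dk n)].
Qed.

Lemma isomorphic_digit_space (Y V : Type) (q : nat) (D K : set int)
    (E : int -> Y -> Y -> Prop) (dig : Y -> int -> nat)
    (p : V -> V) (lev : V -> int) (lab : V -> nat)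
    (A : groupClosed (bij Y)) (B : groupClosed (bij V)) :
  (1 < q)%N -> digit_space q D E dig -> labelled_tree q D p lev lab ->
  (forall a n, D n -> exists2 m : nat, D (n - m%:Z) &
     exists x, matches D dig p lev lab x a (n - m%:Z)) ->
  (forall k, K k -> invariant_under D k) ->
  (forall f : bij Y, f \in A <-> exists2 k, K k &
     forall a b n, D n -> (E n a b <-> E (n + k) (f a) (f b))) ->
  (forall g : bij V, g \in B <-> exists2 k, K k & tree_shift D p lev k (bij_fun g)) ->
  isomorphic (subgroup A) (subgroup B).
Proof.
move=> q1 ds lt base KD memA memB.
have [beta [bt bE]] := exists_ball_tree ds lt base q1.
apply: (isomorphic_ball_tree bt (ds_level ds) KD _ memB) => f.
split=> [/memA[k Kk fk]|[k Kk fk]].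
  by exists k => //; exact/(ball_shiftE _ (KD k Kk) bE).
by apply/memA; exists k => //; exact/(ball_shiftE _ (KD k Kk) bE).
Qed.

Theorem theorem1 (R : realType) (F : localField R) :
  [/\ (forall (V : eqType) (e : rel V) (r : V),
         rooted_regular_tree e r (residue_card F) ->
         isomorphic (Isom (ring_of_integers R F)) (RootedAut e r)),
      (forall (V : eqType) (e : rel V) (omega : set (nat -> V)) (v : nat -> V),
         regular_tree e (residue_card F).+1 -> is_end e omega -> omega v ->
         isomorphic (Isom (vspace R F)) (EndAut0 e v))
    & (forall (V : eqType) (e : rel V) (omega : set (nat -> V)),
         regular_tree e (residue_card F).+1 -> is_end e omega ->
         isomorphic (Dil (vspace R F)) (EndAut e omega)) ].
Proof.
have q1 := residue_card_gt1 F.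
have [dig [dig0 digE dig_onto dig_lt]] := exists_digits F.
have inv0 (D : set int) k : [set 0] k -> invariant_under D k.
  by move=> -> n; rewrite addr0.
have dsF := digit_space_field (F := F) digE dig_onto dig_lt.
(* Far enough out, the ball around [a] contains 0, so the digits of [a] from there on are 0, like
   the labels of the ray. *)
have base (V : Type) (p : V -> V) lev lab (v : nat -> V) :
    (forall n i, [/\ lev (v n) = - n%:Z, lab (v n) = 0%N & iter i p (v n) = v (n + i)%N]) ->
    forall a n, setT n -> exists2 m : nat, setT (n - m%:Z) &
      exists x, matches setT dig p lev lab x a (n - m%:Z).
  move=> vP a n _; have [m0 am0] := close_join n a 0.
  (* Adding [absz n] makes [n - m] nonpositive, hence the level of a vertex of the ray. *)
  pose m := (m0 + absz n)%N; exists m => //; exists (v (absz (n - m%:Z))).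
  have am : close (n - m%:Z) a 0 by apply: close_le am0; rewrite /m; lia.
  split; first by have [-> _ _] := vP (absz (n - m%:Z)) 0%N; rewrite /m; lia.
  move=> k _; have [_ _ ->] := vP (absz (n - m%:Z)) k.
  have [_ -> _] := vP (absz (n - m%:Z) + k)%N 0%N.
  rewrite -(dig0 (n - m%:Z - k%:Z)); apply/esym.
  rewrite -[n - m%:Z - k%:Z](subrK 1); apply/digE; rewrite ?subrK.
    by apply: close_le am; lia.
  by apply: close_le am; lia.
split=> [V e r rt|V e omega v rt oe ov|V e omega rt oe].
- have [p [lev [lab [lt lr memB]]]] := rooted_tree_structure rt.
  have ds := digit_space_integers (F := F) digE dig_onto dig_lt.
  apply: (isomorphic_digit_space q1 ds lt _ (inv0 _) _ memB).
    (* The descent starts at level 0, where the root matches every integer: level -1 lies outside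
       [nonneg], so no digit is compared. *)
    move=> a n n0; exists (absz n).
      by move: n0; rewrite /nonneg/=; lia.
    exists r; split; first by move: n0; rewrite lr /nonneg/=; lia.
    by move=> k; move: n0; rewrite /nonneg/=; lia.
  exact: isometry_integers_close.
- have [p [lev [lab [lt vP memB _]]]] := end_tree_structure (ltnW q1) rt oe ov.
  apply: (isomorphic_digit_space q1 dsF lt (base _ _ _ _ _ vP) (inv0 _) _ memB).
  exact: isometry_close.
- have [v ov] : omega !=set0.
    by case: oe => u ur ->; exists u; split=> //; exists 0%N, 0%N.
  have [p [lev [lab [lt vP _ memB]]]] := end_tree_structure (ltnW q1) rt oe ov.
  apply: (isomorphic_digit_space q1 dsF lt (base _ _ _ _ _ vP) _ _ memB) => //.
  exact: dilation_close.
Qed.
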